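(* Let $k\ge1$ be an integer. There is a constant $\alpha=\alpha(k)>0$ depending only on $k$ and, for all $D$ and $L$, a constant $C=C(k,D,L)>0$ depending only on $k$, $D$ and $L$, such that the following holds. Let $\mu$ be a non-atomic probability measure on a measurable space $(X,\mathcal X)$, let $n\ge1$ be an integer, let $\xi_1,\dots,\xi_n$ be independent $(X,\mathcal X)$-valued random variables with distribution $\mu$, and let $\mathcal F$ be an $L_2$-dense class with exponent $L$ and parameter $D$ of functions on the $k$-fold product space $(X^k,\mathcal X^k)$ which is either countable or countably majorizable in $(X^k,\mathcal X^k,\mu^k)$. Assume that $\sup_{x_j\in X,\,1\le j\le k}|f(x_1,\dots,x_k)|\le1$ for all $f\in\mathcal F$. Then $$P\left(\sup_{f\in\mathcal F}|J_{n,k}(f)|\ge x\right)\le C e^{-\alpha x^{2/k}}\qquad\text{for all } x>0.$$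
   Context: A set $\mathcal G$ of real-valued measurable functions on a measurable space $(Y,\mathcal Y)$ is an $L_2$-dense class with parameter $D$ and exponent $L$ if for all $0<\varepsilon\le1$ and all probability measures $\nu$ on $(Y,\mathcal Y)$ there is a finite subset $\{g_1,\dots,g_m\}\subset\mathcal G$ (possibly depending on $\nu$ and $\varepsilon$) with $m\le D\varepsilon^{-L}$ such that $\inf_{1\le j\le m}\int|g-g_j|^2\,d\nu<\varepsilon^2$ for all $g\in\mathcal G$. The empirical measure of the sample is $\mu_n(A)=\frac1n\#\{j:\xi_j\in A,\ 1\le j\le n\}$, $A\in\mathcal X$. The random integral $J_{n,k}(f)$ is $$J_{n,k}(f)=\frac{n^{k/2}}{k!}\int' f(u_1,\dots,u_k)\,(\mu_n(du_1)-\mu(du_1))\cdots(\mu_n(du_k)-\mu(du_k)),$$ where the prime means that the diagonals $u_j=u_l$, $1\le j<l\le k$, are omitted from the domain of integration. A class $\mathcal F$ is countably majorizable in $(X^k,\mathcal X^k,\mu^k)$ if there is a countable subset $\mathcal F'\subset\mathcal F$ such that for all $x>0$ the sets $A(x)=\{\omega:\sup_{f\in\mathcal F}|J_{n,k}(f)(\omega)|\ge x\}$ and $B(x)=\{\omega:\sup_{f\in\mathcal F'}|J_{n,k}(f)(\omega)|\ge x\}$ satisfy $P(A(x)\setminus B(x))=0$ (i.e. $A(x)\setminus B(x)$ is a null set; probabilities are understood with respect to the completed measure). *)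

(* Defs.v *)
From HB Require Import structures.
From mathcomp Require Import all_boot all_order all_algebra.
From mathcomp Require Import all_classical all_reals all_analysis.
From mathcomp Require Import measurable_realfun.

Set Implicit Arguments.
Unset Strict Implicit.
Unset Printing Implicit Defensive.

Import Order.TTheory GRing.Theory Num.Theory.
Import numFieldNormedType.Exports.

Local Open Scope classical_set_scope.
Local Open Scope ring_scope.

Section measure_notions.
Context {R : realType}.

Definition non_atomic d (X : measurableType d) (mu : {measure set X -> \bar R}) :=
  forall A, measurable A -> (0 < mu A)%E ->
    exists B, [/\ measurable B, B `<=` A, (0 < mu B)%E & (mu B < mu A)%E].

Definition mutually_independent d d' (Omega : measurableType d)
    (X : measurableType d') (P : probability Omega R) (n : nat)
    (xi : 'I_n -> {RV P >-> X}) :=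
  forall (J : {set 'I_n}) (A : 'I_n -> set X), (forall j, measurable (A j)) ->
    P (\bigcap_(j in [set` J]) xi j @^-1` A j) =
    (\prod_(j in J) P (xi j @^-1` A j))%E.

(* The infimum over an empty subfamily is +oo, so a nonempty G needs 0 < m. *)
Definition L2_dense d (Y : measurableType d) (D L : R) (G : set (Y -> R)) :=
  (forall g, G g -> measurable_fun setT g) /\
  forall (eps : R) (nu : probability Y R), 0 < eps <= 1 ->
    exists (m : nat) (h : 'I_m -> Y -> R),
      [/\ m%:R <= D * eps `^ (- L),
          forall j, G (h j) &
          forall g, G g ->
            (ereal_inf (range (fun j =>
               \int[nu]_y (`|g y - h j y| ^+ 2)%:E)) < (eps ^+ 2)%:E)%E].

End measure_notions.

Section empirical_measure.
Context {R : realType} d (X : measurableType d) (n : nat).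
Variable y : 'I_n -> X.

Definition empirical (A : set X) : \bar R :=
  (n%:R^-1 * #|[pred j : 'I_n | y j \in A]|%:R)%:E.

Let weight : {nonneg R} := (n%:R^-1)%:nng.

Let y_ (k : nat) : X := if insub k is Some j then y j else point.

Let empirical_dirac :
  empirical = mscale weight (msum (fun k => \d_(y_ k)) n).
Proof.
apply/funext => A; rewrite /empirical /mscale /= EFinM; congr (_ * _)%E.
rewrite /msum (eq_bigr (fun j : 'I_n => (y j \in A)%:R%:E)); last first.
  by move=> j _; rewrite [LHS]diracE /y_ valK.
rewrite sumEFin -sum1_card natr_sum big_mkcond; congr EFin.
by apply: eq_bigr => j _; rewrite inE; case: ifP.
Qed.

Let empirical0 : empirical set0 = 0%E.
Proof. by rewrite empirical_dirac measure0. Qed.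

Let empirical_ge0 A : (0 <= empirical A)%E.
Proof. by rewrite empirical_dirac measure_ge0. Qed.

Let empirical_sigma_additive : semi_sigma_additive empirical.
Proof. by rewrite empirical_dirac; exact: measure_semi_sigma_additive. Qed.

HB.instance Definition _ := isMeasure.Build _ _ _ empirical
  empirical0 empirical_ge0 empirical_sigma_additive.

(* Integral against the empirical measure.  The library integral only has the
   right value on measurable integrands, but removing the diagonals from a
   product space makes non-measurable ones when the sigma-algebra does not
   contain the singletons; the finite sum makes sense for every integrand. *)
Definition empirical_integral (g : X -> R) : R := n%:R^-1 * \sum_(j < n) g (y j).

Lemma ge0_empirical_integralE (g : X -> R) : measurable_fun setT g ->
  (forall x, 0 <= g x) ->
  (\int[empirical]_x (g x)%:E)%E = (empirical_integral g)%:E.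
Proof.
move=> mg g0.
have mg' : measurable_fun setT (fun x => (g x)%:E) by exact/measurable_EFinP.
have -> : (\int[empirical]_x (g x)%:E =
    \int[mscale weight (msum (fun k => \d_(y_ k)) n)]_x (g x)%:E)%E.
  by apply: eq_measure_integral => A _ _; exact: (congr1 (@^~ A) empirical_dirac).
have g0' x : [set: X] x -> (0 <= (g x)%:E)%E by rewrite lee_fin.
rewrite ge0_integral_mscale//= ge0_integral_measure_sum//.
rewrite /empirical_integral EFinM -sumEFin; congr (_ * _)%E.
by apply: eq_bigr => j _; rewrite integral_dirac//= diracT mul1e /y_ valK.
Qed.

Lemma empirical_integralE (g : X -> R) : measurable_fun setT g ->
  (\int[empirical]_x (g x)%:E)%E = (empirical_integral g)%:E.
Proof.
move=> mg; rewrite integralE.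
rewrite (funerpos g : (fun x => (g x)%:E)^\+%E = _).
rewrite (funerneg g : (fun x => (g x)%:E)^\-%E = _).
rewrite ge0_empirical_integralE//; last exact: measurable_funrpos.
rewrite ge0_empirical_integralE//; last exact: measurable_funrneg.
rewrite -EFinB /empirical_integral -mulrBr -sumrB; congr (_ * _)%:E.
by apply: eq_bigr => j _; rewrite -[in RHS](funrposBneg g).
Qed.

End empirical_measure.

Section random_integral.
Context {R : realType} d (X : measurableType d).

(* \int ( ... (\int f(u_1,...,u_k) nu(du_k)) ... ) nu(du_1), for a signed
   measure nu given by its integration functional; the k-fold product of charges
   is not available, and for bounded measurable f the two agree by Fubini. *)
Fixpoint iterated_integral (nu : (X -> R) -> R) (k : nat) :
    (k.-tuple X -> R) -> R :=
  if k is k'.+1 then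
    fun f => nu (fun u => iterated_integral nu (fun v => f [tuple of u :: v]))
  else fun f => f [tuple].

Definition off_diagonal (k : nat) (f : k.-tuple X -> R) : k.-tuple X -> R :=
  fun u => if uniq u then f u else 0.

(* The mu-integrals may meet non-measurable integrands, but for non-atomic mu these
   differ from measurable ones only on finitely many points, which lie in a
   mu-null set, so that the library integral has the expected value. *)
Definition random_integral (mu : probability X R) (n k : nat) (y : 'I_n -> X)
    (f : k.-tuple X -> R) : R :=
  n%:R `^ (k%:R / 2) / (k`!)%:R *
  iterated_integral (fun g => empirical_integral y g - \int[mu]_x g x)
    (off_diagonal f).

Context d' (Omega : measurableType d') (P : probability Omega R).

(* The supremum of an empty family is -oo.  This event is in general measurable
   only for the completion of P. *)
Definition sup_event (mu : probability X R) (n k : nat)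
    (xi : 'I_n -> {RV P >-> X}) (F : set (k.-tuple X -> R)) (x : R) :
    set Omega :=
  [set w | (x%:E <=
    ereal_sup [set `|random_integral mu (fun j => xi j w) f|%:E | f in F])%E].

Definition countably_majorizable (mu : probability X R) (n k : nat)
    (xi : 'I_n -> {RV P >-> X}) (F : set (k.-tuple X -> R)) :=
  exists F' : set (k.-tuple X -> R), [/\ countable F', F' `<=` F &
    forall x : R, 0 < x ->
      P.-negligible (sup_event mu xi F x `\` sup_event mu xi F' x)].

End random_integral.

(* Main.v *)
Require Import Defs.
From HB Require Import structures.
From mathcomp Require Import all_boot all_order all_algebra.
From mathcomp Require Import all_classical all_reals all_analysis.
From mathcomp Require Import measurable_realfun.
From mathcomp Require Import ring lra.

Set Implicit Arguments.
Unset Strict Implicit.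
Unset Printing Implicit Defensive.

Import Order.TTheory GRing.Theory Num.Theory.
Import numFieldNormedType.Exports.

Local Open Scope classical_set_scope.
Local Open Scope ring_scope.

(** Up to the factor [1 / k!], the random integral at a sample of distinct points
    is an average over the colorings [pi] of the indices [1, ..., n] by the [k]
    coordinates ([iterated_integral_coloring]): the coordinate [i] is integrated
    against [sqrt n] times the difference between [k / n] times the sum of the
    unit masses at the points of color [i] and [mu].  Coordinates of different
    colors never share an index, so the diagonals disappear and, given the
    coloring, the coordinates are independent.  The same average accounts for
    the fact that the random integral is not degenerate: the points of one color
    have a total mass that fluctuates around [sqrt n], and the difference,
    [shift], is a sum of independent centered variables.  As [mu] is non-atomic,
    sample points are almost surely distinct ([non_atomic_diagonal]) and the
    points removed with the diagonals do not affect the integrals against [mu]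
    ([Eint_off_finite]).

    It then suffices to bound, for each coloring, the moment of order [2 q] of
    the supremum over finitely many functions.  Replacing the integrals against
    [mu] by averages over a ghost sample and over one extra point for each color
    ([multi_centered_ghost]), and exchanging sample points with their ghosts
    ([symmetrization]), reduces this to a fixed sample with random signs.  There
    the integrals are decoupled Rademacher chaoses of order [k], whose moments
    of order [2 q] are controlled by the L2-norm with respect to a discrete
    measure, whose mass is a product of [k] factors of order [q], up to the
    imbalance of the coloring ([chaos_moment]); this is the measure to which
    L2-density is applied ([L2_dense_discrete]).  Chaining ([chaining])
    passes to the supremum: the entropy affects only the constant in front as
    soon as [q] exceeds [2 L].  Averaging over the colorings gives the moment
    bound [C (A q) ^ (k q)], where [A] depends on [k] only ([sup_moment]), and
    Markov's inequality with [q] of order [x ^ (2 / k)] concludes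
    ([tail_moment], [optimize_exponent]). *)

(** * Moments of sums of independent centered variables *)

Definition fupd (T S : finType) (s : {ffun T -> S}) (i : T) (c : S) :
  {ffun T -> S} := [ffun j => if j == i then c else s j].

Section Averages.
Context {R : realFieldType}.

Definition avg (I : finType) (F : I -> R) : R := #|I|%:R^-1 * \sum_i F i.

Lemma eq_avg (I : finType) (F G : I -> R) : F =1 G -> avg F = avg G.
Proof. by move=> FG; congr (_ * _); apply: eq_bigr. Qed.

Lemma ler_avg (I : finType) (F G : I -> R) :
  (forall i, F i <= G i) -> avg F <= avg G.
Proof. by move=> FG; rewrite ler_wpM2l ?invr_ge0 ?ler0n// ler_sum. Qed.

Lemma avg_ge0 (I : finType) (F : I -> R) : (forall i, 0 <= F i) -> 0 <= avg F.
Proof. by move=> F0; rewrite mulr_ge0 ?invr_ge0 ?ler0n// sumr_ge0. Qed.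

Lemma avgD (I : finType) (F G : I -> R) :
  avg (fun i => F i + G i) = avg F + avg G.
Proof. by rewrite /avg big_split mulrDr. Qed.

Lemma avgZl (I : finType) a (F : I -> R) : avg (fun i => a * F i) = a * avg F.
Proof. by rewrite /avg -mulr_sumr mulrCA. Qed.

Lemma avgN (I : finType) (F : I -> R) : avg (fun i => - F i) = - avg F.
Proof. by rewrite /avg sumrN mulrN. Qed.

Lemma avgB (I : finType) (F G : I -> R) :
  avg (fun i => F i - G i) = avg F - avg G.
Proof. by rewrite avgD avgN. Qed.

Lemma avg_sum (I : finType) (J : Type) (r : seq J) (P : pred J) (F : J -> I -> R) :
  avg (fun i => \sum_(j <- r | P j) F j i) = \sum_(j <- r | P j) avg (F j).
Proof. by rewrite /avg exchange_big mulr_sumr. Qed.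

Lemma avg_cst (I : finType) (a : R) : (0 < #|I|)%N -> avg (fun _ : I => a) = a.
Proof.
move=> I0; rewrite /avg sumr_const -[a *+ _]mulr_natl mulKf//.
by rewrite pnatr_eq0 -lt0n.
Qed.

Lemma avg_exchange (I J : finType) (F : I -> J -> R) :
  avg (fun i => avg (F i)) = avg (fun j => avg (F^~ j)).
Proof.
rewrite [LHS]/avg /avg -!mulr_sumr exchange_big/= mulrCA; congr (_ * _).
Qed.

(** Exchanging the coordinate [i] of the function with the independent value
    permutes the pairs over which the right-hand side averages. *)
Lemma avg_resample (T S : finType) (i : T) (F : S -> {ffun T -> S} -> R) :
  (0 < #|S|)%N ->
  (forall c s c', F c (fupd s i c') = F c s) ->
  avg (fun s : {ffun T -> S} => F (s i) s) = avg (fun s => avg (fun c => F c s)).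
Proof.
move=> S0 Fi; rewrite -[LHS](avg_cst _ S0) avg_exchange /avg -!mulr_sumr.
congr (_ * (_ * _)); rewrite !pair_bigA/=.
pose h (p : {ffun T -> S} * S) : {ffun T -> S} * S :=
  (fupd p.1 i p.2, p.1 i).
have hK : involutive h.
  move=> [s c]; rewrite /h/= ffunE eqxx; congr pair.
  by apply/ffunP => j; rewrite !ffunE; case: eqP => // ->.
rewrite (reindex_inj (inv_inj hK))/=; apply: eq_bigr => -[s c] _ /=.
by rewrite ffunE eqxx Fi.
Qed.

(** Tangent lines give Jensen's inequality for averages and for integrals alike. *)
Lemma expr_tangent (m x : R) q : 0 <= m -> 0 <= x ->
  m ^+ q + q%:R * m ^+ q.-1 * (x - m) <= x ^+ q.
Proof.
move=> m0 x0; case: q => [|q]/=; first by rewrite !expr0 !mul0r addr0.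
elim: q => [|q ih]; first by rewrite !expr1 expr0 mulr1 mul1r addrC subrK.
have -> : x ^+ q.+2 = x * x ^+ q.+1 by rewrite exprS.
apply: le_trans (ler_wpM2l x0 ih); rewrite -subr_ge0.
have -> : x * (m ^+ q.+1 + q.+1%:R * m ^+ q * (x - m))
   - (m ^+ q.+2 + q.+2%:R * m ^+ q.+1 * (x - m))
  = q.+1%:R * m ^+ q * (x - m) ^+ 2 by rewrite !exprS -!natr1; ring.
by rewrite mulr_ge0 ?sqr_ge0// mulr_ge0 ?ler0n ?exprn_ge0.
Qed.

Lemma expr_even_tangent (m x : R) q :
  (m ^+ 2) ^+ q + (q%:R * (m ^+ 2) ^+ q.-1 * (2 * m)) * (x - m) <= (x ^+ 2) ^+ q.
Proof.
apply: le_trans (expr_tangent q (sqr_ge0 m) (sqr_ge0 x)).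
rewrite lerD2l -!mulrA ler_wpM2l ?ler0n// ler_wpM2l//.
  by rewrite exprn_ge0// sqr_ge0.
rewrite -subr_ge0.
have -> : x ^+ 2 - m ^+ 2 - 2 * (m * (x - m)) = (x - m) ^+ 2 by ring.
exact: sqr_ge0.
Qed.

Lemma avg_expr_even (I : finType) (F : I -> R) q :
  (0 < #|I|)%N -> (avg F ^+ 2) ^+ q <= avg (fun i => (F i ^+ 2) ^+ q).
Proof.
move=> I0; set m := avg F; set s := q%:R * (m ^+ 2) ^+ q.-1 * (2 * m).
have <- : avg (fun i => (m ^+ 2) ^+ q + s * (F i - m)) = (m ^+ 2) ^+ q.
  by rewrite avgD avgZl avgB !avg_cst// subrr mulr0 addr0.
by apply: ler_avg => i; exact: expr_even_tangent.
Qed.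

Lemma wsum_expr (J : Type) (r : seq J) (l x : J -> R) q :
  (forall j, 0 <= l j) -> (forall j, 0 <= x j) -> \sum_(j <- r) l j = 1 ->
  (\sum_(j <- r) l j * x j) ^+ q <= \sum_(j <- r) l j * x j ^+ q.
Proof.
move=> l0 x0 l1; set m := \sum_(j <- r) l j * x j.
have m0 : 0 <= m by rewrite sumr_ge0// => j _; rewrite mulr_ge0.
have <- : \sum_(j <- r) l j * (m ^+ q + q%:R * m ^+ q.-1 * (x j - m)) = m ^+ q.
  under eq_bigr do rewrite mulrDr mulrCA mulrBr.
  rewrite big_split/= -mulr_suml l1 mul1r -mulr_sumr sumrB -mulr_suml l1 mul1r.
  by rewrite -/m subrr mulr0 addr0.
by apply: ler_sum => j _; rewrite ler_wpM2l// expr_tangent.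
Qed.

Lemma convex_expr2 (u v x y : R) q : 0 < u -> 0 < v -> 0 <= x -> 0 <= y ->
  ((x + y) / (u + v)) ^+ q <=
  u / (u + v) * (x / u) ^+ q + v / (u + v) * (y / v) ^+ q.
Proof.
move=> u0 v0 x0 y0; have uv0 : 0 < u + v by rewrite addr_gt0.
have := @wsum_expr bool [:: true; false] (fun b => (if b then u else v) / (u + v))
  (fun b => if b then x / u else y / v) q.
rewrite !big_cons !big_nil/= !addr0.
have -> : u / (u + v) * (x / u) + v / (u + v) * (y / v) = (x + y) / (u + v).
  by field; rewrite !gt_eqF.
by apply; [case; rewrite divr_ge0// ltW|case; rewrite divr_ge0// ltW|
  rewrite -mulrDl divff// gt_eqF].
Qed.

Lemma ler_exprn (x y : R) n : 0 <= x -> x <= y -> x ^+ n <= y ^+ n.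
Proof. by move=> x0 xy; rewrite lerXn2r ?nnegrE// (le_trans x0). Qed.

(** Minkowski's inequality in L_q, by convexity of the power at the normalized
    functions [U / u] and [V / v]. *)
Lemma avg_minkowski (I : finType) (U V : I -> R) (u v : R) q :
  (0 < q)%N -> (forall i, 0 <= U i) -> (forall i, 0 <= V i) ->
  0 <= u -> 0 <= v ->
  avg (fun i => U i ^+ q) <= u ^+ q -> avg (fun i => V i ^+ q) <= v ^+ q ->
  avg (fun i => (U i + V i) ^+ q) <= (u + v) ^+ q.
Proof.
move=> q0 U0 V0 u0 v0 hU hV.
have vanish (W : I -> R) : (forall i, 0 <= W i) ->
    avg (fun i => W i ^+ q) <= 0 ^+ q -> forall i, W i = 0.
  move=> W0; rewrite expr0n (gtn_eqF q0) => hW i; apply/eqP.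
  have I0 : (0 < #|I|%:R :> R) by rewrite ltr0n; apply/card_gt0P; exists i.
  have: \sum_i W i ^+ q <= 0 by move: hW; rewrite /avg pmulr_rle0 ?invr_gt0.
  move=> hW'; have W0' j : true -> 0 <= W j ^+ q by move=> _; rewrite exprn_ge0.
  have /eqP: \sum_i W i ^+ q = 0 by apply/le_anti; rewrite hW' sumr_ge0.
  by rewrite psumr_eq0// => /allP/(_ i); rewrite mem_index_enum expf_eq0 q0 => /(_ isT).
move: u0; rewrite le_eqVlt => /predU1P[u0|u0].
  rewrite -u0 in hU *; rewrite add0r (le_trans _ hV)// ler_avg// => i.
  by rewrite (vanish _ U0 hU) add0r.
move: v0; rewrite le_eqVlt => /predU1P[v0|v0].
  rewrite -v0 in hV *; rewrite addr0 (le_trans _ hU)// ler_avg// => i.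
  by rewrite (vanish _ V0 hV) addr0.
have uv0 : 0 < u + v by rewrite addr_gt0.
rewrite -[leRHS]mulr1 -ler_pdivrMl ?exprn_gt0// -avgZl.
apply: (@le_trans _ _ (avg (fun i =>
    u / (u + v) * (u ^- q * U i ^+ q) + v / (u + v) * (v ^- q * V i ^+ q)))).
  apply: ler_avg => i; rewrite -!exprVn -!exprMn ![_^-1 * _]mulrC.
  exact: convex_expr2.
rewrite avgD !avgZl.
have hU' : u ^- q * avg (fun i => U i ^+ q) <= 1.
  by rewrite ler_pdivrMl ?mulr1 ?exprn_gt0.
have hV' : v ^- q * avg (fun i => V i ^+ q) <= 1.
  by rewrite ler_pdivrMl ?mulr1 ?exprn_gt0.
apply: le_trans (lerD (ler_wpM2l _ hU') (ler_wpM2l _ hV')) _;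
  [by rewrite divr_ge0// ltW|by rewrite divr_ge0// ltW|].
by rewrite !mulr1 -mulrDl divff// gt_eqF.
Qed.

(** Induction on [q] for the even part [E] and the odd part [O] of the binomial
    expansion, together with [a b O <= 2 q a ^ 2 E]. *)
Lemma two_point (a b : R) q :
  (((b + a) ^+ 2) ^+ q + ((b - a) ^+ 2) ^+ q) / 2 <=
  (b ^+ 2 + 4 * q%:R * a ^+ 2) ^+ q.
Proof.
pose E p : R := (((b + a) ^+ 2) ^+ p + ((b - a) ^+ 2) ^+ p) / 2.
pose O p : R := (((b + a) ^+ 2) ^+ p - ((b - a) ^+ 2) ^+ p) / 2.
have ES p : E p.+1 = (b ^+ 2 + a ^+ 2) * E p + 2 * (a * b * O p).
  by rewrite /E /O !exprS; field.
have OS p : a * b * O p.+1 =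
    (b ^+ 2 + a ^+ 2) * (a * b * O p) + 2 * (a ^+ 2 * b ^+ 2) * E p.
  by rewrite /E /O !exprS; field.
have E0 p : 0 <= E p by rewrite divr_ge0// addr_ge0// exprn_ge0// sqr_ge0.
have a20 := sqr_ge0 a; have b20 := sqr_ge0 b.
have HO p : 0 <= a * b * O p <= 2 * p%:R * a ^+ 2 * E p.
  elim: p => [|p /andP[ih1 ih2]].
    by rewrite /O !expr0 subrr mul0r !mulr0 !mul0r lexx.
  rewrite OS; apply/andP; split.
    apply: addr_ge0; first by apply: mulr_ge0 => //; exact: addr_ge0.
    by apply: mulr_ge0 => //; apply: mulr_ge0 => //; exact: mulr_ge0.
  apply: (@le_trans _ _ ((b ^+ 2 + a ^+ 2) * (2 * p%:R * a ^+ 2 * E p) +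
      2 * (a ^+ 2 * b ^+ 2) * E p)).
    by rewrite lerD2r ler_wpM2l// addr_ge0.
  rewrite ES -[p.+1%:R]natr1 -subr_ge0.
  have -> : 2 * (p%:R + 1) * a ^+ 2 *
       ((b ^+ 2 + a ^+ 2) * E p + 2 * (a * b * O p)) -
    ((b ^+ 2 + a ^+ 2) * (2 * p%:R * a ^+ 2 * E p) + 2 * (a ^+ 2 * b ^+ 2) * E p)
    = 4 * (p%:R + 1) * a ^+ 2 * (a * b * O p) + 2 * (a ^+ 2 * a ^+ 2) * E p.
    by ring.
  apply: addr_ge0; apply: mulr_ge0 => //.
    by rewrite mulr_ge0// mulr_ge0// addr_ge0.
  by apply: mulr_ge0 => //; exact: mulr_ge0.
suff H : forall p, (p <= q)%N -> E p <= (b ^+ 2 + 4 * q%:R * a ^+ 2) ^+ p.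
  exact: H.
elim=> [_|p ih pq]; first by rewrite /E !expr0; lra.
have /andP[_ Op] := HO p.
have := ih (ltnW pq); set M := (_ + _) => {}ih.
have M0 : 0 <= M by apply: addr_ge0 => //; do 2 apply: mulr_ge0 => //.
rewrite exprS; apply: le_trans (ler_wpM2l M0 ih); rewrite ES.
rewrite -subr_ge0 /M.
have -> : (b ^+ 2 + 4 * q%:R * a ^+ 2) * E p -
    ((b ^+ 2 + a ^+ 2) * E p + 2 * (a * b * O p)) =
   2 * (2 * p%:R * a ^+ 2 * E p - a * b * O p) +
   (4 * (q%:R - p%:R) - 1) * (a ^+ 2 * E p) by ring.
have qp : p%:R + 1 <= q%:R :> R by rewrite natr1 ler_nat.
apply: addr_ge0; first by apply: mulr_ge0 => //; rewrite subr_ge0.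
by apply: mulr_ge0; [lra|exact: mulr_ge0].
Qed.

(** Centering by an independent copy makes the increment symmetric, which
    reduces the claim to [two_point]. *)
Lemma avg_centered_step (S : finType) (xi : S -> R) (r a b : R) q :
  (0 < #|S|)%N -> \sum_c xi c = 0 -> (forall c c', `|xi c - xi c'| <= r) ->
  avg (fun c => ((b + xi c * a) ^+ 2) ^+ q) <=
  (b ^+ 2 + 4 * q%:R * r ^+ 2 * a ^+ 2) ^+ q.
Proof.
move=> S0 xi0 xir.
pose G c c' := ((b + (xi c - xi c') * a) ^+ 2) ^+ q.
apply: (@le_trans _ _ (avg (fun c => avg (G c)))).
  apply: ler_avg => c.
  have -> : b + xi c * a = avg (fun c' => b + (xi c - xi c') * a).
    under eq_avg do rewrite mulrBl addrA.
    rewrite avgB avg_cst//; under eq_avg do rewrite mulrC.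
    by rewrite avgZl /avg xi0 !mulr0 subr0.
  exact: avg_expr_even.
have -> : avg (fun c => avg (G c)) =
    avg (fun c => avg (fun c' => (G c c' + G c' c) / 2)).
  under [RHS]eq_avg do (under eq_avg do rewrite mulrC; rewrite avgZl avgD).
  rewrite avgZl avgD [X in _ + X]avg_exchange; set X := avg _; lra.
apply: (@le_trans _ _ (avg (fun c : S => avg (fun c' : S =>
   (b ^+ 2 + 4 * q%:R * r ^+ 2 * a ^+ 2) ^+ q)))); last by rewrite !avg_cst.
apply: ler_avg => c; apply: ler_avg => c'.
have -> : G c' c = ((b - (xi c - xi c') * a) ^+ 2) ^+ q.
  by rewrite /G; congr ((_ ^+ _) ^+ _); ring.
apply: le_trans (two_point _ _ _) _.
apply: ler_exprn.
  by apply: addr_ge0; [exact: sqr_ge0|apply: mulr_ge0; rewrite ?sqr_ge0// mulr_ge0].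
rewrite lerD2l exprMn -[leRHS]mulrA; apply: ler_wpM2l; first exact: mulr_ge0.
apply: ler_wpM2r; first exact: sqr_ge0.
by rewrite -[leLHS]real_normK ?num_real//; exact: ler_exprn.
Qed.

(** The increments enter one at a time: given the other coordinates, each of
    them is handled by [avg_centered_step], and Minkowski's inequality separates
    its contribution from the rest. *)
Lemma avg_centered_sum (T S : finType) (xi : S -> R) (r : R) q (J : seq T)
    (B : {ffun T -> S} -> R) (a : T -> {ffun T -> S} -> R) (beta : R)
    (alpha : T -> R) :
  (0 < q)%N -> (0 < #|S|)%N -> \sum_c xi c = 0 ->
  (forall c c', `|xi c - xi c'| <= r) -> uniq J ->
  (forall j s c, j \in J -> B (fupd s j c) = B s) ->
  (forall i j s c, i \in J -> j \in J ->
     a i (fupd s j c) = a i s) ->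
  0 <= beta -> (forall i, 0 <= alpha i) ->
  avg (fun s => (B s ^+ 2) ^+ q) <= beta ^+ q ->
  (forall i, i \in J -> avg (fun s => (a i s ^+ 2) ^+ q) <= alpha i ^+ q) ->
  avg (fun s : {ffun T -> S} =>
    ((B s + \sum_(j <- J) xi (s j) * a j s) ^+ 2) ^+ q) <=
  (beta + 4 * q%:R * r ^+ 2 * \sum_(j <- J) alpha j) ^+ q.
Proof.
move=> q0 S0 xi0 xir + + + beta0 alpha0 hB.
elim: J => [|j J ih] /= uJ Bi ai ha.
  by under eq_avg do rewrite big_nil addr0; rewrite big_nil mulr0 addr0.
move: uJ => /andP[jJ uJ].
pose B' (s : {ffun T -> S}) := B s + \sum_(j <- J) xi (s j) * a j s.
under eq_avg do rewrite big_cons addrCA addrC.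
rewrite -/(avg (fun s => ((B' s + xi (s j) * a j s) ^+ 2) ^+ q)).
have c0 : 0 <= 4 * q%:R * r ^+ 2 by rewrite mulr_ge0 ?sqr_ge0// mulr_ge0.
have neq i : i \in J -> (i == j) = false.
  by move=> iJ; apply/negbTE/eqP => ij; rewrite -ij iJ in jJ.
rewrite (@avg_resample _ _ j (fun c s => ((B' s + xi c * a j s) ^+ 2) ^+ q))//;
  last first.
  move=> c s c'; rewrite /B' Bi ?mem_head// ai ?mem_head//.
  congr (((_ + _ + _) ^+ _) ^+ _); rewrite !big_seq; apply: eq_bigr => i iJ.
  by rewrite ffunE neq// ai// ?mem_head ?inE ?iJ ?orbT.
apply: (@le_trans _ _ (avg (fun s =>
   (B' s ^+ 2 + 4 * q%:R * r ^+ 2 * a j s ^+ 2) ^+ q))).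
  by apply: ler_avg => s; exact: avg_centered_step.
rewrite big_cons mulrDr addrCA addrC.
apply: avg_minkowski => //.
- by move=> s; exact: sqr_ge0.
- by move=> s; apply: mulr_ge0 => //; exact: sqr_ge0.
- by apply: addr_ge0 => //; apply: mulr_ge0 => //; exact: sumr_ge0.
- exact: mulr_ge0.
- apply: ih => //.
  + by move=> i s c iJ; rewrite Bi// inE iJ orbT.
  + by move=> i l s c iJ lJ; rewrite ai// inE ?iJ ?lJ orbT.
  + by move=> i iJ; rewrite ha// inE iJ orbT.
- under eq_avg do rewrite exprMn.
  rewrite avgZl [leRHS]exprMn ler_wpM2l ?exprn_ge0//.
  by rewrite ha ?mem_head.
Qed.

End Averages.

(** * Iterated functionals and decoupled chaoses *)

Section Multi.
Context {R : realFieldType} {X : Type}.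

(** The functionals are numbered from the innermost one, so that the recursive
    call leaves the family [nu] unchanged and reads only its first [k'] members. *)
Fixpoint multi (nu : nat -> (X -> R) -> R) (k : nat) :
    (k.-tuple X -> R) -> R :=
  if k is k'.+1 then
    fun f => nu k' (fun u => multi nu (fun v => f [tuple of u :: v]))
  else fun f => f [tuple].

Lemma eq_multi nu nu' k (f : k.-tuple X -> R) :
  (forall i, (i < k)%N -> nu i =1 nu' i) -> multi nu f = multi nu' f.
Proof.
elim: k f => [//|k ih] f h /=; rewrite h//; congr (nu' k _).
by apply/funext => u; apply: ih => i ik; apply: h; rewrite ltnS ltnW.
Qed.

Definition linear_functional (nu : (X -> R) -> R) :=
  forall a g h, nu (fun u => a * g u + h u) = a * nu g + nu h.

Lemma multi_linear nu k a (f g : k.-tuple X -> R) :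
  (forall i, linear_functional (nu i)) ->
  multi nu (fun v => a * f v + g v) = a * multi nu f + multi nu g.
Proof.
move=> l; elim: k f g => [//|k ih] f g /=; rewrite -l; congr (nu k _).
by apply/funext => u; rewrite ih.
Qed.

Lemma linear_functional0 nu : linear_functional nu -> nu (fun=> 0) = 0.
Proof.
move=> l; have := l 1 (fun=> 0) (fun=> 0); rewrite !mul1r addr0.
by move/eqP; rewrite -subr_eq0 opprD addrA subrr sub0r oppr_eq0 => /eqP.
Qed.

Lemma multi_ge0 nu k (f : k.-tuple X -> R) :
  (forall i g, (forall u, 0 <= g u) -> 0 <= nu i g) ->
  (forall v, 0 <= f v) -> 0 <= multi nu f.
Proof.
move=> h; elim: k f => [f f0 /=|k ih f f0 /=]; first exact: f0.
by apply: h => u; apply: ih.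
Qed.

Lemma multi_cst nu k : (forall i, linear_functional (nu i)) ->
  multi nu (fun _ : k.-tuple X => 1) = \prod_(i < k) nu i (fun=> 1).
Proof.
move=> l; elim: k => [|k ih]; first by rewrite big_ord0.
rewrite big_ord_recr /= ih; set p := \prod_(_ < _) _.
by have := l k p (fun=> 1) (fun=> 0); rewrite linear_functional0// mulr1 !addr0.
Qed.

(** The absolute values stand for the nonnegativity of the weights, and are
    compatible with products. *)
Lemma multi_discrete (nu : nat -> (X -> R) -> R) k :
  (forall i, exists s : seq (R * X), forall g, nu i g = \sum_(p <- s) `|p.1| * g p.2) ->
  exists s : seq (R * k.-tuple X), forall f : k.-tuple X -> R,
    multi nu f = \sum_(p <- s) `|p.1| * f p.2.
Proof.
move=> h; elim: k => [|k [s hs]].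
  exists [:: (1, [tuple])] => f; rewrite big_seq1 normr1 mul1r.
  by congr f; apply: val_inj.
have [t ht] := h k.
exists [seq ((p : R * X).1 * (r : R * k.-tuple X).1, [tuple of p.2 :: r.2])
  | p <- t, r <- s] => f /=.
rewrite big_allpairs_dep ht; apply: eq_bigr => p _.
by rewrite hs mulr_sumr; apply: eq_bigr => r _ /=; rewrite normrM mulrA.
Qed.

End Multi.

Section Chaos.
Context {R : realFieldType} {X : Type} {n K : nat}.
Variables (y y' : 'I_n -> X) (z : nat -> X) (kap : nat -> R) (c : R).
Variable pi : 'I_n -> 'I_K.

(** The points of color [i] and their ghosts enter with a random sign, the mass
    [kap i] at the extra point [z i] without one. *)
Definition signed (e : {ffun 'I_n -> bool}) (i : nat) (g : X -> R) : R :=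
  kap i * g (z i) +
  \sum_(j | pi j == i :> nat) (-1) ^+ e j * (c * (g (y j) - g (y' j))).

(** The form controlling the moments of order [2 q] of [signed].  Only the random
    part carries the factor [q]: the moments of [kap] over the colorings provide
    their own.  The constant is [4 * 2 ^ 2] from [avg_centered_sum], signs being
    at distance at most [2], times [4] for the difference of two values of [g]. *)
Definition energy (q : nat) (i : nat) (g : X -> R) : R :=
  kap i ^+ 2 * g (z i) +
  \sum_(j | pi j == i :> nat) 64 * q%:R * c ^+ 2 * (g (y j) + g (y' j)).

Lemma signed_linear e i : linear_functional (signed e i).
Proof.
move=> a g h; rewrite /signed [in RHS]mulrDr [RHS]addrACA [in RHS]mulr_sumr -big_split/=.
by congr (_ + _); [ring|apply: eq_bigr => j _; ring].
Qed.

Lemma energy_linear q i : linear_functional (energy q i).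
Proof.
move=> a g h; rewrite /energy [in RHS]mulrDr [RHS]addrACA [in RHS]mulr_sumr -big_split/=.
by congr (_ + _); [ring|apply: eq_bigr => j _; ring].
Qed.

Lemma energy_ge0 q i g : (forall u, 0 <= g u) -> 0 <= energy q i g.
Proof.
move=> g0; apply: addr_ge0; first by rewrite mulr_ge0 ?sqr_ge0.
apply: sumr_ge0 => j _; apply: mulr_ge0; last exact: addr_ge0.
by rewrite mulr_ge0 ?sqr_ge0// mulr_ge0.
Qed.

Lemma multi_signed_fupd e j b k (f : k.-tuple X -> R) : (k <= pi j)%N ->
  multi (signed (fupd e j b)) f = multi (signed e) f.
Proof.
move=> kj; apply: eq_multi => i ik g; congr (_ + _); apply: eq_bigr => l /eqP li.
rewrite /fupd ffunE; case: eqP => // lj.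
by move: kj; rewrite -lj li leqNgt ik.
Qed.

(** Hypercontractivity of the decoupled Rademacher chaos, with shifts [kap]:
    the signs of the color [k] are independent of the integrals over the lower
    colors, so that each level is an instance of [avg_centered_sum]. *)
Lemma chaos_moment q k (f : k.-tuple X -> R) : (0 < q)%N ->
  avg (fun e => (multi (signed e) f ^+ 2) ^+ q) <=
  multi (energy q) (fun v => f v ^+ 2) ^+ q.
Proof.
move=> q0; have S0 : (0 < #|{: {ffun 'I_n -> bool}}|)%N.
  by apply/card_gt0P; exists [ffun=> true].
elim: k f => [|k ih] f; first by rewrite /= avg_cst.
pose Q u := multi (energy q) (fun v : k.-tuple X => f [tuple of u :: v] ^+ 2).
have Q0 u : 0 <= Q u.
  by apply: multi_ge0 => [i g|v]; [exact: energy_ge0|exact: sqr_ge0].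
pose G (e : {ffun 'I_n -> bool}) u :=
  multi (signed e) (fun v : k.-tuple X => f [tuple of u :: v]).
pose J := [seq j <- enum 'I_n | pi j == k :> nat].
have GJ j e b u : j \in J -> G (fupd e j b) u = G e u.
  by rewrite mem_filter => /andP[/eqP jk _]; apply: multi_signed_fupd; rewrite jk.
have hG u : avg (fun e => (G e u ^+ 2) ^+ q) <= Q u ^+ q by exact: ih.
have := @avg_centered_sum R 'I_n bool (fun b => (-1) ^+ b) 2 q J
  (fun e => kap k * G e (z k)) (fun j e => c * (G e (y j) - G e (y' j)))
  (kap k ^+ 2 * Q (z k)) (fun j => 4 * c ^+ 2 * (Q (y j) + Q (y' j))).
set L := (X in _ -> _ -> _ -> _ -> _ -> _ -> _ -> _ -> _ -> _ -> _ -> X).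
suff -> : is_true (avg (fun e => (multi (signed e) f ^+ 2) ^+ q) <=
    multi (energy q) (fun v => f v ^+ 2) ^+ q) = L.
  apply => //; rewrite ?card_bool//.
  - by rewrite big_bool/= expr0 expr1 addNr.
  - by case; case; rewrite /= ?expr0 ?expr1 ler_norml; lra.
  - by rewrite filter_uniq// enum_uniq.
  - by move=> j e b jJ; rewrite GJ.
  - by move=> i j e b iJ jJ; rewrite !GJ.
  - by rewrite mulr_ge0 ?sqr_ge0.
  - by move=> i; rewrite mulr_ge0 ?addr_ge0// mulr_ge0 ?sqr_ge0.
  - under eq_avg do rewrite [(kap k * _) ^+ 2]exprMn exprMn.
    by rewrite avgZl [leRHS]exprMn ler_wpM2l// exprn_ge0// sqr_ge0.
  - move=> i _; apply: (@le_trans _ _ (avg (fun e =>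
      (2 * c ^+ 2 * G e (y i) ^+ 2 + 2 * c ^+ 2 * G e (y' i) ^+ 2) ^+ q))).
      apply: ler_avg => e; apply: ler_exprn; first exact: sqr_ge0.
      rewrite -subr_ge0 (_ : _ - _ = c ^+ 2 * (G e (y i) + G e (y' i)) ^+ 2).
        by rewrite mulr_ge0 ?sqr_ge0.
      by ring.
    have -> : 4 * c ^+ 2 * (Q (y i) + Q (y' i)) =
      4 * c ^+ 2 * Q (y i) + 4 * c ^+ 2 * Q (y' i) by ring.
    have c2 : 0 <= c ^+ 2 by exact: sqr_ge0.
    have h u : avg (fun e => (2 * c ^+ 2 * G e u ^+ 2) ^+ q) <=
        (4 * c ^+ 2 * Q u) ^+ q.
      under eq_avg do rewrite exprMn.
      rewrite avgZl [leRHS]exprMn; apply: ler_pM => //.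
      - by rewrite exprn_ge0// mulr_ge0.
      - by apply: avg_ge0 => e; rewrite exprn_ge0// sqr_ge0.
      - by apply: ler_exprn; [exact: mulr_ge0|lra].
    by apply: avg_minkowski => // [e|e||]; rewrite mulr_ge0 ?sqr_ge0// mulr_ge0.
rewrite /L; congr (is_true (_ <= _ ^+ _)).
  apply: eq_avg => e; congr ((_ ^+ _) ^+ _) => /=.
  by rewrite /signed/= /J big_filter big_enum_cond.
rewrite /= /energy -/(Q _); congr (_ + _).
rewrite /J big_filter big_enum_cond/= mulr_sumr; apply: eq_bigr => j _.
by rewrite -!/(Q _); ring.
Qed.

End Chaos.

(** * Chaining in an L2-dense class *)

Section DiscreteMeasure.
Context {R : realType} d (Y : measurableType d).
Variable s : seq (R * Y).

Let w (i : nat) : {nonneg R} := `|(nth (0, point) s i).1|%:nng.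
Let p (i : nat) : Y := (nth (0, point) s i).2.
Let mass : R := \sum_(r <- s) `|r.1|.
Let massi : {nonneg R} := `|mass^-1|%:nng.

Local Notation nu := (mscale massi (msum (fun i => mscale (w i) (\d_(p i))) (size s))).

Let ge0_integral_nu (g : Y -> R) : 0 < mass -> measurable_fun setT g ->
  (forall y, 0 <= g y) ->
  (\int[nu]_y (g y)%:E = (mass^-1 * \sum_(r <- s) `|r.1| * g r.2)%:E)%E.
Proof.
move=> M0 mg g0.
have mg' : measurable_fun setT (fun x => (g x)%:E) by exact/measurable_EFinP.
have g0' x : [set: Y] x -> (0 <= (g x)%:E)%E by rewrite lee_fin.
rewrite ge0_integral_mscale//= ge0_integral_measure_sum//.
rewrite EFinM ger0_norm ?invr_ge0 ?ltW//; congr (_ * _)%E.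
rewrite (big_nth (0, point)) big_mkord -sumEFin; apply: eq_bigr => i _.
by rewrite ge0_integral_mscale//= integral_dirac//= diracT mul1e EFinM.
Qed.

(** L2-density with respect to the normalization of the discrete measure with
    weights [`|r.1|] at the points [r.2]. *)
Lemma L2_dense_discrete (D L : R) (G : set (Y -> R)) (eps : R) :
  L2_dense D L G -> 0 < mass -> 0 < eps <= 1 ->
  exists r : seq (Y -> R), [/\ (size r)%:R <= D * eps `^ (- L),
    forall h, h \in r -> G h &
    forall g, G g -> exists2 h, h \in r &
      \sum_(a <- s) `|a.1| * (g a.2 - h a.2) ^+ 2 <= eps ^+ 2 * mass].
Proof.
move=> [mG dG] M0 eps01.
have nuT : nu setT = 1%E.
  rewrite -[LHS]mul1e -[in LHS](integral_cst nu measurableT 1).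
  rewrite (ge0_integral_nu M0 (measurable_cst _) (fun=> ler01)); congr EFin.
  by under eq_bigr do rewrite mulr1; rewrite mulVf// gt_eqF.
pose nu0 : {measure set Y -> \bar R} := nu.
pose Nu : probability Y R := HB.pack_for (probability Y R)
  (Measure.sort nu0) (Measure_isProbability.Build _ _ _ nu0 nuT).
have [m [h [mD hG hd]]] := dG eps Nu eps01.
exists [seq h j | j <- enum 'I_m]; split.
- by rewrite size_map size_enum_ord.
- by move=> _ /mapP[j _ ->].
- move=> g Gg; have /ereal_inf_lt[_ [j _ <-]] := hd g Gg.
  move=> hj; exists (h j); first by apply/mapP; exists j; rewrite ?mem_enum.
  move: hj; rewrite (_ : (\int[Nu]_y _)%E =
    (\int[nu]_y ((g y - h j y) ^+ 2)%:E)%E); last first.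
    by apply: eq_integral => y _; rewrite real_normK// num_real.
  rewrite ge0_integral_nu//; last 2 first.
  + by apply: measurable_funX; apply: measurable_funB; exact: mG.
  + by move=> y; exact: sqr_ge0.
  by rewrite lte_fin ltr_pdivrMl// mulrC => /ltW.
Qed.

End DiscreteMeasure.

Section Chaining.
Context {R : realType}.

(** Jensen's inequality with the weights [2 ^- l.+1]. *)
Lemma telescope_expr (t : nat -> R) q m : (0 < q)%N ->
  ((\sum_(l < m) t l) ^+ 2) ^+ q <=
  \sum_(l < m) 2^-1 ^+ l.+1 * ((2 ^+ l.+1 * t l) ^+ 2) ^+ q.
Proof.
move=> q0; elim: m t => [|m ih] t.
  by rewrite !big_ord0 -exprM expr0n muln_eq0/= gtn_eqF.
rewrite !big_ord_recl/=; set S := \sum_(_ < _) _.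
have := ih (fun l => 2 * t l.+1); rewrite -mulr_sumr -/S => ihS.
have -> : t 0%N + S = avg (fun b : bool => if b then 2 * t 0%N else 2 * S).
  by rewrite /avg card_bool big_bool/=; lra.
apply: le_trans (avg_expr_even _ _ _) _; first by rewrite card_bool.
rewrite /avg card_bool big_bool/= mulrDr !expr1 lerD2l.
apply: le_trans (ler_wpM2l _ ihS) _; first by rewrite invr_ge0.
rewrite mulr_sumr; apply: ler_sum => l _.
by rewrite /bump/= !add1n [leLHS]mulrA -exprS [_ * (2 * _)]mulrA -exprSr.
Qed.

Lemma powR_net (L : R) l : (8^-1 ^+ l) `^ (- L) = (8 `^ L) ^+ l.
Proof.
have e8 : 0 <= 8^-1 :> R by rewrite invr_ge0.
rewrite -[_ ^+ l in LHS](powR_mulrn l e8) -[8^-1](@powR_inv1 _ 8)// -!powRrM.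
by rewrite -powR_mulrn ?powR_ge0// -powRrM; congr (_ `^ _); ring.
Qed.

(** Chaining at the levels [8 ^- l].  The moment exponent [2 q] beats the
    entropy as soon as [q] exceeds [2 L], which is why the constant in front of
    [mass] depends neither on [D] nor on [L]. *)
Lemma chaining d (Y : measurableType d) (D L : R) (G : set (Y -> R))
    (s : seq (R * Y)) (I : finType) (Z : I -> (Y -> R) -> R) (q N : nat)
    (f : 'I_N -> Y -> R) :
  L2_dense D L G -> (forall g, G g -> forall y, `|g y| <= 1) ->
  let mass : R := \sum_(r <- s) `|r.1| in
  0 < mass -> (0 < q)%N -> 2 * L <= q%:R ->
  (forall i, linear_functional (Z i)) ->
  (forall g, avg (fun i => (Z i g ^+ 2) ^+ q) <=
     (\sum_(r <- s) `|r.1| * g r.2 ^+ 2) ^+ q) ->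
  (forall j, G (f j)) ->
  avg (fun i => \big[Num.max/0]_(j < N) ((Z i (f j) ^+ 2) ^+ q)) <=
  (`|D| + D ^+ 2 * 8 `^ L + 1) * (64 * mass) ^+ q.
Proof.
move=> dG G1 mass M0 q0 qL Zl Zm Gf.
pose nrm (g : Y -> R) : R := \sum_(r <- s) `|r.1| * g r.2 ^+ 2.
pose P := 8 `^ L.
have P0 : 0 < P by rewrite powR_gt0.
have net l : exists r : seq (Y -> R), [/\ (size r)%:R <= D * P ^+ l,
    forall h, h \in r -> G h &
    forall g, G g -> exists2 h, h \in r &
      nrm (fun y => g y - h y) <= 64^-1 ^+ l * mass].
  have e01 : 0 < (8^-1 ^+ l : R) <= 1.
    by rewrite exprn_gt0 ?invr_gt0//= exprn_ile1// ?invr_ge0// invf_le1 ?ler1n.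
  have [r [rD rG rd]] := L2_dense_discrete dG M0 e01.
  exists r; split => //; first by rewrite /P -powR_net.
  move=> g Gg; have [h hr gh] := rd g Gg; exists h => //.
  apply: le_trans gh _; rewrite -exprM mulnC exprM.
  by rewrite (_ : 8^-1 ^+ 2 = 64^-1 :> R)//; field.
have [r hr] := choice net.
have rG l h : h \in r l -> G h by case: (hr l) => _ + _; apply.
have /choice[pr prP] : forall lg : nat * (Y -> R), exists h, G lg.2 ->
    h \in r lg.1 /\ nrm (fun y => lg.2 y - h y) <= 64^-1 ^+ lg.1 * mass.
  move=> [l g]; have [Gg|Gg] := pselect (G g); last by exists (fun=> 0).
  by case: (hr l) => _ _ /(_ g Gg)[h h1 h2]; exists h.
pose p l g := pr (l, g).
have pr1 l g : G g -> p l g \in r l by move=> Gg; exact: (prP (l, g) Gg).1.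
have pr2 l g : G g -> nrm (fun y => g y - p l g y) <= 64^-1 ^+ l * mass.
  by move=> Gg; exact: (prP (l, g) Gg).2.
have nrm0 g : 0 <= nrm g.
  by apply: sumr_ge0 => a _; rewrite mulr_ge0 ?sqr_ge0.
have nrm1 g : G g -> nrm g <= mass.
  move=> Gg; apply: ler_sum => a _; rewrite -[leRHS]mulr1 ler_wpM2l//.
  by rewrite -real_normK ?num_real// exprn_ile1// G1.
have nrmD g h : nrm (fun y => g y + h y) <= 2 * (nrm g + nrm h).
  rewrite -big_split mulr_sumr/=; apply: ler_sum => a _.
  rewrite -mulrDr [leRHS]mulrCA ler_wpM2l//.
  rewrite -subr_ge0 (_ : _ - _ = (g a.2 - h a.2) ^+ 2); first exact: sqr_ge0.
  by ring.
have ZB i g h : Z i (fun y => g y - h y) = Z i g - Z i h.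
  have := Zl i (-1) h g; rewrite mulN1r addrC => <-; congr (Z i _).
  by apply/funext => y; rewrite mulN1r addrC.
pose z2 i g := (Z i g ^+ 2) ^+ q.
have z20 i g : 0 <= z2 i g by rewrite exprn_ge0 ?sqr_ge0.
have avg_z2 g : avg (z2^~ g) <= nrm g ^+ q by exact: Zm.
have le_seq (r' : seq (Y -> R)) (F : (Y -> R) -> R) h : h \in r' ->
    (forall g, 0 <= F g) -> F h <= \sum_(g <- r') F g.
  move=> hr' F0; rewrite (big_rem h)//= lerDl sumr_ge0//.
(* Increments between consecutive nets are summed over all pairs of net points at
   a distance compatible with a common approximated function.  This makes [T]
   independent of [f j] except in the last increment, where the number [N] of
   functions is compensated by the level. *)
pose close l (h g : Y -> R) := nrm (fun y => h y - g y) <= 4 * 64^-1 ^+ l * mass.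
pose T0 i := \sum_(h <- r 0%N) z2 i h.
pose T1 l i := \sum_(h <- r l.+1) \sum_(g <- r l)
  (if close l h g then z2 i (fun y => h y - g y) else 0).
pose T2 i := \sum_(j < N) z2 i (fun y => f j y - p N (f j) y).
pose c l : R := 2^-1 ^+ l * (4 ^+ l) ^+ q.
pose T i := c 1%N * T0 i + \sum_(l < N) c l.+2 * T1 l i + c N.+2 * T2 i.
have c0 l : 0 <= c l by rewrite mulr_ge0// exprn_ge0// ?invr_ge0// exprn_ge0.
have T00 i : 0 <= T0 i by rewrite sumr_ge0.
have T10 l i : 0 <= T1 l i.
  by rewrite sumr_ge0// => h _; rewrite sumr_ge0// => g _; case: ifP.
have T20 i : 0 <= T2 i by rewrite sumr_ge0.
have zT i j : z2 i (f j) <= T i.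
  pose t l := if l is l'.+1 then
      (if (l' < N)%N then Z i (p l'.+1 (f j)) - Z i (p l' (f j))
       else Z i (f j) - Z i (p N (f j)))
    else Z i (p 0%N (f j)).
  have tel m : (m <= N)%N -> \sum_(l < m.+1) t l = Z i (p m (f j)).
    elim: m => [|m ih] mN; first by rewrite big_ord_recr big_ord0/= add0r.
    by rewrite big_ord_recr/= ih ?(ltnW mN)// mN addrC subrK.
  have -> : z2 i (f j) = ((\sum_(l < N.+2) t l) ^+ 2) ^+ q.
    by rewrite big_ord_recr/= tel// ltnn addrC subrK.
  apply: le_trans (telescope_expr _ _ q0) _.
  have ce l x : 2^-1 ^+ l * ((2 ^+ l * x) ^+ 2) ^+ q = c l * (x ^+ 2) ^+ q.
    rewrite /c -mulrA; congr (_ * _); rewrite -exprMn; congr (_ ^+ _).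
    by rewrite exprMn -exprM mulnC exprM; congr (_ ^+ _ * _); ring.
  rewrite big_ord_recr big_ord_recl/= !ce ltnn.
  apply: lerD; first apply: lerD.
  - by rewrite ler_wpM2l//; apply: (le_seq (r 0%N) (z2 i)) => //; exact: pr1.
  - apply: ler_sum => l _; rewrite /bump/= add1n ltn_ord ce ler_wpM2l//.
    set h := p l.+1 (f j); set g := p l (f j).
    apply: (@le_trans _ _ (\sum_(g <- r l)
       (if close l h g then z2 i (fun y => h y - g y) else 0))); last first.
      apply: (le_seq _ (fun h => \sum_(g <- r l)
         (if close l h g then z2 i (fun y => h y - g y) else 0))).
        exact: pr1.
      by move=> h'; rewrite sumr_ge0// => g' _; case: ifP.
    apply: (@le_trans _ _
      (if close l h g then z2 i (fun y => h y - g y) else 0)); last first.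
      apply: (le_seq _ (fun g =>
         if close l h g then z2 i (fun y => h y - g y) else 0)).
        exact: pr1.
      by move=> g'; case: ifP.
    suff -> : close l h g by rewrite /z2 ZB.
    rewrite /close.
    rewrite (_ : (fun y => _) = fun y => (f j y - g y) + (h y - f j y)); last first.
      by apply/funext => y; ring.
    apply: le_trans (nrmD _ _) _.
    have -> : nrm (fun y => h y - f j y) = nrm (fun y => f j y - h y).
      by apply: eq_bigr => a _; rewrite -sqrrN opprB.
    have := pr2 l (f j) (Gf j); have := pr2 l.+1 (f j) (Gf j); rewrite -/h -/g.
    rewrite exprS => h1 h2.
    have : 0 <= 64^-1 ^+ l * mass.
      by rewrite mulr_ge0 ?exprn_ge0 ?invr_ge0// ltW.
    by move: h1 h2; rewrite -mulrA -[4 * _ * _]mulrA; set e := 64^-1 ^+ l * mass; lra.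
  - rewrite ler_wpM2l// /T2 (bigD1 j)//= /z2 ZB lerDl sumr_ge0// => i0 _.
    exact: z20.
apply: (@le_trans _ _ (avg T)).
  apply: ler_avg => i; apply/bigmax_leP; split; last by move=> j _; exact: zT.
  apply: addr_ge0; last by rewrite mulr_ge0.
  apply: addr_ge0; first by rewrite mulr_ge0.
  by rewrite sumr_ge0// => l _; rewrite mulr_ge0.
have mq0 : 0 <= mass ^+ q by rewrite exprn_ge0// ltW.
(* The pairs at level [l] number at most [D ^+ 2 * P ^+ (2 l + 1)], while the
   moments of their increments, weighted by [c l.+2], decay like
   [16 ^- (q * l)]. *)
have P16 : P ^+ 2 <= 16 ^+ q.
  apply: (@le_trans _ _ (8 ^+ q)); last by apply: ler_exprn => //; lra.
  rewrite /P -powR_mulrn ?powR_ge0// -powRrM -powR_mulrn//.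
  by rewrite ler_powR ?ler1n// mulrC.
have aT0 : avg T0 <= `|D| * mass ^+ q.
  rewrite /T0 avg_sum; apply: (@le_trans _ _ (\sum_(h <- r 0%N) mass ^+ q)).
    rewrite !big_seq; apply: ler_sum => h hr0; apply: le_trans (avg_z2 _) _.
    by apply: ler_exprn => //; apply: nrm1; exact: rG hr0.
  rewrite big_const_seq count_predT iter_addr_0 -mulr_natl ler_wpM2r//.
  case: (hr 0%N) => + _ _; rewrite expr0 mulr1 => /le_trans; apply.
  exact: ler_norm.
have aT1 l : avg (T1 l) <= D ^+ 2 * P * (P ^+ 2) ^+ l * (4 * 64^-1 ^+ l * mass) ^+ q.
  set x := (_ ^+ q).
  have x0 : 0 <= x.
    by rewrite exprn_ge0// mulr_ge0 ?(ltW M0)// mulr_ge0// exprn_ge0// invr_ge0.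
  rewrite /T1 avg_sum.
  apply: (@le_trans _ _ (\sum_(h <- r l.+1) \sum_(g <- r l) x)).
    apply: ler_sum => h _; rewrite avg_sum; apply: ler_sum => g _.
    case hg: (close l h g); last by rewrite /avg sumr_const mul0rn mulr0.
    by apply: le_trans (avg_z2 _) _; exact: ler_exprn.
  rewrite !big_const_seq !count_predT !iter_addr_0 -mulrnA -mulr_natl ler_wpM2r//.
  have [s1 _ _] := hr l.+1; have [s2 _ _] := hr l.
  rewrite natrM; apply: le_trans (ler_pM (ler0n _ _) (ler0n _ _) s2 s1) _.
  rewrite le_eqVlt; apply/orP; left; apply/eqP.
  by rewrite exprS -exprM mulnC exprM; ring.
have aT2 : avg T2 <= N%:R * (64^-1 ^+ N * mass) ^+ q.
  rewrite /T2 avg_sum mulr_natl -[X in _ *+ X]card_ord -sumr_const.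
  apply: ler_sum => j _; apply: le_trans (avg_z2 _) _.
  by apply: ler_exprn => //; exact: pr2.
have cT1 (l : nat) : c l.+2 * avg (T1 l) <=
    2^-1 ^+ l.+1 * (D ^+ 2 * P * (64 * mass) ^+ q).
  apply: le_trans (ler_wpM2l (c0 _) (aT1 l)) _.
  have e16 : 16^-1 = 4 * 64^-1 :> R by field.
  have E : (4 ^+ l.+2) ^+ q * (4 * 64^-1 ^+ l * mass) ^+ q =
      (64 * mass) ^+ q * (16^-1 ^+ q) ^+ l.
    rewrite -exprMn -[(16^-1 ^+ q) ^+ l]exprM mulnC exprM -exprMn.
    by congr (_ ^+ q); rewrite e16 exprMn !exprS; ring.
  rewrite (_ : c l.+2 * _ = 2^-1 ^+ l.+2 * (D ^+ 2 * P * (64 * mass) ^+ q) *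
     (P ^+ 2 * 16^-1 ^+ q) ^+ l); last first.
    rewrite /c [(P ^+ 2 * _) ^+ l]exprMn; set u := (P ^+ 2) ^+ l.
    transitivity (2^-1 ^+ l.+2 * D ^+ 2 * P * u *
      ((4 ^+ l.+2) ^+ q * (4 * 64^-1 ^+ l * mass) ^+ q)); first by ring.
    by rewrite E; ring.
  have Q0 : 0 <= D ^+ 2 * P * (64 * mass) ^+ q.
    apply: mulr_ge0; first by rewrite mulr_ge0 ?sqr_ge0// ltW.
    by rewrite exprn_ge0// mulr_ge0// ltW.
  have h2 n : 0 <= 2^-1 ^+ n :> R by rewrite exprn_ge0// invr_ge0.
  apply: (@le_trans _ _ (2^-1 ^+ l.+2 * (D ^+ 2 * P * (64 * mass) ^+ q))).
    apply: ler_piMr; first exact: mulr_ge0.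
    apply: exprn_ile1.
      by rewrite mulr_ge0 ?sqr_ge0// exprn_ge0// invr_ge0.
    by rewrite exprVn ler_pdivrMr ?mul1r// exprn_gt0.
  by rewrite ler_wpM2r// [leLHS]exprS ler_piMl// invf_le1// ler1n.
have half : \sum_(l < N) 2^-1 ^+ l.+1 <= 1 :> R.
  suff -> : \sum_(l < N) 2^-1 ^+ l.+1 = 1 - 2^-1 ^+ N :> R.
    by rewrite gerBl exprn_ge0// invr_ge0.
  elim: N {f Gf T2 T zT T20 aT2} => [|m ih]; first by rewrite big_ord0 expr0 subrr.
  by rewrite big_ord_recr/= ih exprS; field.
rewrite [leLHS](_ : _ = c 1%N * avg T0 + \sum_(l < N) c l.+2 * avg (T1 l) +
   c N.+2 * avg T2); last first.
  rewrite /T !avgD; congr (_ + _ + _); [by rewrite avgZl| |by rewrite avgZl].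
  rewrite avg_sum; by apply: eq_bigr => l _; rewrite avgZl.
have M64 : 0 <= (64 * mass) ^+ q by rewrite exprn_ge0// mulr_ge0// ltW.
rewrite mulrDl mulrDl mul1r; apply: lerD; first apply: lerD.
- apply: le_trans (ler_wpM2l (c0 _) aT0) _; rewrite mulrCA ler_wpM2l//.
  rewrite /c !expr1 -mulrA -exprMn.
  apply: (@le_trans _ _ (1 * (64 * mass) ^+ q)); last by rewrite mul1r.
  apply: ler_pM => //.
  + by rewrite exprn_ge0// mulr_ge0// ltW.
  + by rewrite invf_le1// ler1n.
  + apply: ler_exprn; first by rewrite mulr_ge0// ltW.
    by rewrite ler_wpM2r// ?ltW//; lra.
- apply: (@le_trans _ _ (\sum_(l < N) 2^-1 ^+ l.+1 *
     (D ^+ 2 * P * (64 * mass) ^+ q))); first by apply: ler_sum => l _; exact: cT1.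
  rewrite -mulr_suml ler_piMl// mulr_ge0// mulr_ge0 ?sqr_ge0// ltW//.
- apply: le_trans (ler_wpM2l (c0 _) aT2) _.
  rewrite /c mulrACA -exprMn.
  apply: (@le_trans _ _ (1 * (64 * mass) ^+ q)); last by rewrite mul1r.
  have h64 : 0 <= 64^-1 ^+ N :> R by rewrite exprn_ge0// invr_ge0.
  apply: ler_pM.
  + by rewrite mulr_ge0// exprn_ge0// invr_ge0.
  + by rewrite exprn_ge0// mulr_ge0 ?exprn_ge0// mulr_ge0// ltW.
  + rewrite exprVn mulrC ler_pdivrMr ?exprn_gt0// mul1r -natrX ler_nat.
    apply: (@leq_trans (2 ^ N)); first by rewrite ltnW// ltn_expl.
    by rewrite leq_exp2l// -addn2 leq_addr.
  + apply: ler_exprn; first by rewrite mulr_ge0 ?exprn_ge0// mulr_ge0// ltW.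
    rewrite mulrA ler_wpM2r ?ltW// !exprS.
    rewrite (_ : 4 * (4 * 4 ^+ N) * 64^-1 ^+ N = 16 * (4 * 64^-1) ^+ N); last first.
      by rewrite exprMn; ring.
    have : (4 * 64^-1) ^+ N <= 1 :> R by rewrite exprn_ile1//; lra.
    by lra.
Qed.

End Chaining.

(** * Integration of bounded measurable functions *)

Section BoundedMeasurable.
Context {R : realType}.

(** The real-valued integral of these functions against a probability is finite,
    hence linear and monotone without further conditions. *)
Definition bmf d (T : measurableType d) (g : T -> R) :=
  measurable_fun setT g /\ exists M, forall t, `|g t| <= M.

Section closure.
Context d (T : measurableType d).
Implicit Types g h : T -> R.

Lemma bmf_cst (a : R) : bmf (fun _ : T => a).
Proof. by split; [exact: measurable_cst|exists `|a|]. Qed.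

Lemma bmfD g h : bmf g -> bmf h -> bmf (fun t => g t + h t).
Proof.
move=> [mg [M gM]] [mh [N hN]]; split; first exact: measurable_funD.
by exists (M + N) => t; rewrite (le_trans (ler_normD _ _))// lerD.
Qed.

Lemma bmfM g h : bmf g -> bmf h -> bmf (fun t => g t * h t).
Proof.
move=> [mg [M gM]] [mh [N hN]]; split; first exact: measurable_funM.
by exists (M * N) => t; rewrite normrM ler_pM.
Qed.

Lemma bmfZ a g : bmf g -> bmf (fun t => a * g t).
Proof. by apply: bmfM; exact: bmf_cst. Qed.

Lemma bmfB g h : bmf g -> bmf h -> bmf (fun t => g t - h t).
Proof.
move=> bg bh; rewrite (_ : (fun t => _) = fun t => g t + -1 * h t).
  by apply: bmfD => //; exact: bmfZ.
by apply/funext => t; rewrite mulN1r.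
Qed.

Lemma bmfX g n : bmf g -> bmf (fun t => g t ^+ n).
Proof.
move=> [mg [M gM]]; split; first exact: measurable_funX.
by exists (M ^+ n) => t; rewrite normrX lerXn2r ?nnegrE// (le_trans _ (gM t)).
Qed.

Lemma bmf_sum (J : Type) (r : seq J) (Q : pred J) (g : J -> T -> R) :
  (forall j, bmf (g j)) -> bmf (fun t => \sum_(j <- r | Q j) g j t).
Proof.
move=> bg; elim: r => [|j r ih].
  under eq_fun do rewrite big_nil; exact: bmf_cst.
under eq_fun do rewrite big_cons; case: (Q j) => //; exact: bmfD.
Qed.

Lemma bmf_max g h : bmf g -> bmf h -> bmf (fun t => Num.max (g t) (h t)).
Proof.
move=> [mg [M gM]] [mh [N hN]]; split; first exact: measurable_maxr.
exists (Num.max M N) => t; rewrite le_max.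
by case: (leP (g t) (h t)) => _; rewrite ?gM ?hN ?orbT.
Qed.

Lemma bmf_bigmax (J : Type) (r : seq J) (g : J -> T -> R) :
  (forall j, bmf (g j)) -> bmf (fun t => \big[Num.max/0]_(j <- r) g j t).
Proof.
move=> bg; elim: r => [|j r ih].
  under eq_fun do rewrite big_nil; exact: bmf_cst.
under eq_fun do rewrite big_cons; exact: bmf_max.
Qed.

End closure.

Lemma bmf_comp d d' (T : measurableType d) (T' : measurableType d')
  (phi : T -> T') (g : T' -> R) :
  measurable_fun setT phi -> bmf g -> bmf (fun t => g (phi t)).
Proof.
by move=> mphi [mg [M gM]]; split; [exact: measurableT_comp|exists M => t].
Qed.

Section integral.
Context d (T : measurableType d) (P : probability T R).
Implicit Types g h : T -> R.

Lemma bmf_integrable g : bmf g -> P.-integrable setT (EFin \o g).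
Proof.
move=> [mg [M gM]]; apply: measurable_bounded_integrable => //.
  by rewrite (@le_lt_trans _ _ 1%E) ?probability_le1// ltry.
exists M; split; [exact: num_real|move=> N MN t _ /=].
exact: le_trans (gM t) (ltW MN).
Qed.

Lemma Eint_cst (a : R) : \int[P]_t a = a.
Proof.
have e : P setT = 1%E := probability_setT P.
by rewrite Rintegral_cst// [X in fine X]e mulr1.
Qed.

Lemma EintD g h : bmf g -> bmf h ->
  \int[P]_t (g t + h t) = \int[P]_t g t + \int[P]_t h t.
Proof. by move=> bg bh; rewrite RintegralD//; exact: bmf_integrable. Qed.

Lemma EintB g h : bmf g -> bmf h ->
  \int[P]_t (g t - h t) = \int[P]_t g t - \int[P]_t h t.
Proof. by move=> bg bh; rewrite RintegralB//; exact: bmf_integrable. Qed.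

Lemma EintZ a g : bmf g -> \int[P]_t (a * g t) = a * \int[P]_t g t.
Proof. by move=> bg; rewrite RintegralZl//; exact: bmf_integrable. Qed.

Lemma Eint_sum (J : Type) (r : seq J) (Q : pred J) (g : J -> T -> R) :
  (forall j, bmf (g j)) ->
  \int[P]_t (\sum_(j <- r | Q j) g j t) = \sum_(j <- r | Q j) \int[P]_t g j t.
Proof.
move=> bg; elim: r => [|j r ih].
  by rewrite big_nil; under eq_Rintegral do rewrite big_nil; exact: Eint_cst.
rewrite big_cons -ih; under eq_Rintegral do rewrite big_cons.
by case: (Q j) => //; rewrite EintD//; exact: bmf_sum.
Qed.

Lemma le_Eint g h : bmf g -> bmf h -> (forall t, g t <= h t) ->
  \int[P]_t g t <= \int[P]_t h t.
Proof. by move=> bg bh gh; apply: le_Rintegral => //; exact: bmf_integrable. Qed.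

Lemma Eint_bounds g M : bmf g -> (forall t, `|g t| <= M) -> `|\int[P]_t g t| <= M.
Proof.
move=> bg gM; rewrite ler_norml -[- M]Eint_cst -[X in _ && (_ <= X)]Eint_cst.
apply/andP; split; apply: le_Eint => //; try exact: bmf_cst;
  by move=> t; have := gM t; rewrite ler_norml => /andP[].
Qed.

Lemma Eint_jensen g q : bmf g ->
  ((\int[P]_t g t) ^+ 2) ^+ q <= \int[P]_t ((g t ^+ 2) ^+ q).
Proof.
move=> bg; set m := \int[P]_t g t.
set s := q%:R * (m ^+ 2) ^+ q.-1 * (2 * m).
have bgm : bmf (fun t => g t - m) by apply: bmfB => //; exact: bmf_cst.
have <- : \int[P]_t ((m ^+ 2) ^+ q + s * (g t - m)) = (m ^+ 2) ^+ q.
  rewrite EintD; [|exact: bmf_cst|exact: bmfZ].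
  by rewrite EintZ// EintB ?Eint_cst ?subrr ?mulr0 ?addr0//; exact: bmf_cst.
apply: le_Eint.
- by apply: bmfD; [exact: bmf_cst|exact: bmfZ].
- by do 2 apply: bmfX.
- by move=> t; exact: expr_even_tangent.
Qed.

End integral.

Section fubini.
Context d d' (T : measurableType d) (T' : measurableType d').
Variables (P' : probability T' R) (g : T * T' -> R).
Hypothesis bg : bmf g.

Let ig (P : probability T R) : (P \x P')%E.-integrable setT (EFin \o g).
Proof. exact: (bmf_integrable (P \x P')%E). Qed.

Let Fin : fubini_F P' (EFin \o g) = EFin \o (fun t => \int[P']_u g (t, u)).
Proof.
apply/funext => t; rewrite /fubini_F/= /Rintegral fineK//.
apply: integrable_fin_num => //; apply: bmf_integrable.
exact: (bmf_comp (measurable_pair1 t) bg).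
Qed.

Lemma bmf_Eint : bmf (fun t => \int[P']_u g (t, u)).
Proof.
split.
  by have := measurable_fubini_F (ig (\d_(point : T))); rewrite Fin => /measurable_EFinP.
have [mg [M gM]] := bg; exists M => t; apply: Eint_bounds => //.
exact: (bmf_comp (measurable_pair1 t) bg).
Qed.

Lemma Eint_prod (P : probability T R) :
  \int[(P \x P')%E]_p g p = \int[P]_t \int[P']_u g (t, u).
Proof.
by rewrite /Rintegral -(integral12_prod_meas1 (ig P)) Fin.
Qed.

End fubini.

End BoundedMeasurable.

(** * Laws of independent samples *)

Section Rectangles.
Context d (X : measurableType d) (m : nat).

Definition rect (A : 'I_m -> set X) : set (m.-tuple X) :=
  [set t | forall i, A i (tnth t i)].

Lemma measurable_rect (A : 'I_m -> set X) :
  (forall i, measurable (A i)) -> measurable (rect A).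
Proof.
move=> mA; rewrite (_ : rect A =
    \big[setI/setT]_(i < m) ((fun t : m.-tuple X => tnth t i) @^-1` A i)).
  apply: bigsetI_measurable => i _; rewrite -[X in measurable X]setTI.
  exact: measurable_tnth.
rewrite -bigcap_seq; apply/seteqP; split => t h; last first.
  by move=> i; apply: (h i) => /=; rewrite mem_index_enum.
by move=> i /= _; exact: (h i).
Qed.

Lemma rect_generated : measurable =
  <<s [set rect A | A in [set A | forall i, measurable (A i)]] >>.
Proof.
apply/seteqP; split; last first.
  apply: smallest_sub; first exact: sigma_algebra_measurable.
  by move=> _ [A mA <-]; exact: measurable_rect.
apply: smallest_sub; first exact: smallest_sigma_algebra.
move=> S; rewrite -bigcup_seq => -[i _ [B mB <-]].
apply: sub_sigma_algebra; exists (fun j => if j == i then B else setT).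
  by move=> j /=; case: ifP.
rewrite setTI; apply/seteqP; split => t /=.
  by move=> /(_ i); rewrite eqxx.
by move=> Bt j; case: eqP => [->|].
Qed.

(** Rectangles form a pi-system that generates the product sigma-algebra. *)
Lemma rect_unique (R : realType) (P Q : probability (m.-tuple X) R) :
  (forall A, (forall i, measurable (A i)) -> P (rect A) = Q (rect A)) ->
  forall B, measurable B -> P B = Q B.
Proof.
move=> PQ B mB; apply: (measure_unique _ (fun=> setT) rect_generated) => //.
- move=> _ _ [A mA <-] [A' mA' <-]; exists (fun i => A i `&` A' i).
    by move=> i; exact: measurableI.
  apply/seteqP; split => t /=; first by move=> h; split => i; case: (h i).
  by move=> [h h'] i; split.
- by move=> _; exists (fun=> setT) => //; apply/seteqP; split.
- by rewrite bigcup_const//; exists 0%N.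
- by move=> _ [A mA <-]; exact: PQ.
- by move=> _; rewrite (@le_lt_trans _ _ 1%E) ?probability_le1// ltry.
Qed.

End Rectangles.

Section TupleLaw.
Context {R : realType} d (X : measurableType d) (mu : probability X R).

Lemma tuple_law_exists m : exists Q : probability (m.-tuple X) R,
  forall A, (forall i, measurable (A i)) ->
    Q (rect A) = (\prod_(i < m) mu (A i))%E.
Proof.
elim: m => [|m [Q hQ]].
  exists (\d_([tuple] : 0.-tuple X)) => A mA.
  have -> : rect A = setT by apply/seteqP; split => // t _ [].
  by rewrite big_ord0; exact: probability_setT.
have mcons : measurable_fun setT
    (fun p : X * m.-tuple X => [tuple of p.1 :: p.2]).
  exact: measurable_cons.
pose f : {mfun (X * m.-tuple X)%type >-> m.+1.-tuple X} :=
  HB.pack (fun p : X * m.-tuple X => [tuple of p.1 :: p.2])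
    (isMeasurableFun.Build _ _ _ _ _ mcons).
exists (distribution (mu \x Q)%E f) => A mA.
rewrite /distribution/= /pushforward.
rewrite (_ : _ @^-1` _ = A ord0 `*` rect (fun i => A (lift ord0 i))).
  rewrite product_measure1E//; last by apply: measurable_rect => i.
  by rewrite big_ord_recl; congr (_ * _)%E; apply: hQ => i; exact: mA.
apply/seteqP; split => -[x t] /= h.
  by split => [|i]; [have := h ord0|have := h (lift ord0 i); rewrite tnthS].
move=> i; case: (unliftP ord0 i) => [j ->|->]; last exact: h.1.
by rewrite tnthS; exact: h.2.
Qed.

(** The product measure of [m] copies of [mu]. *)
Definition tuple_law m := projT1 (cid (tuple_law_exists m)).

Lemma tuple_law_rect m (A : 'I_m -> set X) : (forall i, measurable (A i)) ->
  tuple_law m (rect A) = (\prod_(i < m) mu (A i))%E.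
Proof. exact: (projT2 (cid (tuple_law_exists m))). Qed.

(** Changes of variables reduce to the measure of rectangles: this serves for the
    law of the sample, for [Eint_resample] and for the exchange of the sample with
    its ghost copy. *)
Lemma Eint_tuple_law m d' (T : measurableType d') (P : probability T R)
    (psi : T -> m.-tuple X) (g : m.-tuple X -> R) :
  measurable_fun setT psi ->
  (forall A, (forall i, measurable (A i)) ->
    P (psi @^-1` rect A) = (\prod_(i < m) mu (A i))%E) ->
  bmf g -> \int[P]_t g (psi t) = \int[tuple_law m]_x g x.
Proof.
move=> mpsi hP bg.
pose f : {mfun T >-> m.-tuple X} :=
  HB.pack psi (isMeasurableFun.Build _ _ _ _ _ mpsi).
have PQ : forall B, measurable B -> distribution P f B = tuple_law m B.
  by apply: rect_unique => A mA; rewrite tuple_law_rect// -hP.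
rewrite /Rintegral [in RHS](eq_measure_integral (distribution P f)); last first.
  by move=> B mB _; exact/esym/PQ.
rewrite integral_distribution//; first by apply/measurable_EFinP; case: bg.
exact: (bmf_integrable P (bmf_comp mpsi bg)).
Qed.

End TupleLaw.

(** * Ghost sample and symmetrization *)

Section Kernels.
Context {R : realType} d (X : measurableType d) (mu : probability X R).

(** The substitution [phi] makes the property stable under adding variables,
    as the induction on the number of integrals in [multi_bmf] requires. *)
Definition bkernel d1 (T : measurableType d1) (N : T -> (X -> R) -> R) :=
  forall d2 (T' : measurableType d2) (phi : T' -> T), measurable_fun setT phi ->
  forall G : T' * X -> R, bmf G -> bmf (fun t => N (phi t) (fun x => G (t, x))).

Section closure.
Context d1 (T : measurableType d1).

Lemma bkernel_eval (p : T -> X) : measurable_fun setT p ->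
  bkernel (fun t g => g (p t)).
Proof.
move=> mp d2 T' phi mphi G bG; apply: (bmf_comp _ bG).
by apply: measurable_fun_pair => //; exact: measurableT_comp.
Qed.

Lemma bkernel_Eint : bkernel (fun (_ : T) g => \int[mu]_x g x).
Proof. by move=> d2 T' phi mphi G bG; exact: (bmf_Eint mu bG). Qed.

Lemma bkernelD (N N' : T -> (X -> R) -> R) : bkernel N -> bkernel N' ->
  bkernel (fun t g => N t g + N' t g).
Proof.
by move=> bN bN' d2 T' phi mphi G bG; apply: bmfD; [exact: bN|exact: bN'].
Qed.

Lemma bkernelB (N N' : T -> (X -> R) -> R) : bkernel N -> bkernel N' ->
  bkernel (fun t g => N t g - N' t g).
Proof.
by move=> bN bN' d2 T' phi mphi G bG; apply: bmfB; [exact: bN|exact: bN'].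
Qed.

Lemma bkernelZ a (N : T -> (X -> R) -> R) : bkernel N ->
  bkernel (fun t g => a * N t g).
Proof. by move=> bN d2 T' phi mphi G bG; apply: bmfZ; exact: bN. Qed.

Lemma bkernel_sum (J : Type) (r : seq J) (Q : pred J)
    (N : J -> T -> (X -> R) -> R) : (forall j, bkernel (N j)) ->
  bkernel (fun t g => \sum_(j <- r | Q j) N j t g).
Proof.
by move=> bN d2 T' phi mphi G bG; apply: bmf_sum => j; exact: bN.
Qed.

End closure.

Lemma multi_bmf d1 (T : measurableType d1) (nu : T -> nat -> (X -> R) -> R) k
    d2 (T' : measurableType d2) (phi : T' -> T) (G : T' * k.-tuple X -> R) :
  (forall i, bkernel (nu ^~ i)) -> measurable_fun setT phi -> bmf G ->
  bmf (fun t => multi (nu (phi t)) (fun v => G (t, v))).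
Proof.
move=> bnu; elim: k d2 T' phi G => [|k ih] d2 T' phi G mphi bG /=.
  by apply: (bmf_comp _ bG); exact: measurable_fun_pair.
apply: (bnu k _ _ _ mphi
  (fun p => multi (nu (phi p.1)) (fun v => G (p.1, [tuple of p.2 :: v])))).
apply: (ih _ _ (phi \o fst) (fun p => G (p.1.1, [tuple of p.1.2 :: p.2]))).
  exact: measurableT_comp.
apply: (bmf_comp _ bG); apply: measurable_fun_pair.
  exact: measurableT_comp.
by apply: measurable_cons => //; exact: measurableT_comp.
Qed.

End Kernels.

Section Resample.
Context {R : realType} d (X : measurableType d) (mu : probability X R) (m : nat).
Local Notation Q := (tuple_law mu m).

Definition tupd (w : m.-tuple X) (i : 'I_m) (u : X) : m.-tuple X :=
  [tuple if j == i then u else tnth w j | j < m].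

(** Renewing the coordinate [i] preserves the law of the tuple, and [G] does not
    see the renewed value in its second argument. *)
Lemma Eint_resample (i : 'I_m) (G : X * m.-tuple X -> R) : bmf G ->
  (forall u w u', G (u, tupd w i u') = G (u, w)) ->
  \int[Q]_w G (tnth w i, w) = \int[mu]_u \int[Q]_w G (u, w).
Proof.
move=> bG Gi; have mG : bmf (fun w : m.-tuple X => G (tnth w i, w)).
  by apply: (bmf_comp _ bG); apply: measurable_fun_pair => //; exact: measurable_tnth.
have mupd : measurable_fun setT (fun p : X * m.-tuple X => tupd p.2 i p.1).
  apply/measurable_fun_tnthP => j.
  rewrite (_ : _ \o _ = fun p : X * m.-tuple X =>
     if j == i then p.1 else tnth p.2 j); last first.
    by apply/funext => p /=; rewrite tnth_mktuple.
  case: (j == i); first exact: measurable_fst.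
  exact: ((measurable_fun_tnthP (@snd X (m.-tuple X))).1 measurable_snd j).
rewrite -(Eint_tuple_law (P := (mu \x Q)%E) mupd _ mG).
  rewrite -Eint_prod//; apply: eq_Rintegral => -[u w] _ /=.
  by rewrite tnth_mktuple eqxx Gi.
move=> A mA; pose A' j := if j == i then setT else A j.
rewrite (_ : _ @^-1` _ = A i `*` rect A').
  rewrite [LHS]product_measure1E//; last first.
    by apply: measurable_rect => j; rewrite /A'; case: ifP.
  transitivity (mu (A i) * \prod_(j < m) mu (A' j))%E.
    by congr (_ * _)%E; apply: tuple_law_rect => j; rewrite /A'; case: ifP.
  rewrite (bigD1 i)//= [RHS](bigD1 i)//= /A' eqxx.
  rewrite (_ : mu setT = 1%E); last exact: probability_setT.
  by rewrite mul1e; congr (_ * _)%E; apply: eq_bigr => j /negbTE ->.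
apply/seteqP; split => -[u w] /= h.
  split; first by have := h i; rewrite tnth_mktuple eqxx.
  by move=> j; rewrite /A'; have := h j; rewrite tnth_mktuple; case: ifP.
move=> j; rewrite tnth_mktuple; have := h.2 j; rewrite /A'.
by case: eqP => // -> _; exact: h.1.
Qed.

End Resample.

Section Symmetrization.
Context {R : realType} d (X : measurableType d) (mu : probability X R).
Context {n K : nat} (pi : 'I_n -> 'I_K) (b c : R).
Local Notation m := (n + K)%N.

(** With [b = sqrt n] and [c = K / b], the points of color [i] are weighted so that
    their average over the colorings is [sqrt n] times the empirical measure.  The
    indices in [B] are those taken by the outer coordinates. *)
Definition centered (B : {set 'I_n}) (y : 'I_n -> X) (i : nat) (g : X -> R) : R :=
  \sum_(j | (j \notin B) && (pi j == i :> nat)) c * g (y j) -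
  b * \int[mu]_u g u.

(** The mass of [centered] when [B] is empty, due to the imbalance of the
    coloring. *)
Definition shift (i : nat) : R := \sum_(j | pi j == i :> nat) c - b.

(** The tuple [w] lists a ghost copy of the sample and one extra point for each
    color. *)
Definition ghost (w : m.-tuple X) (j : 'I_n) : X := tnth w (lshift K j).

Definition extra (w : m.-tuple X) (i : nat) : X :=
  if insub i is Some i' then tnth w (rshift n i') else point.

Lemma measurable_ghost j : measurable_fun setT (ghost ^~ j).
Proof. exact: measurable_tnth. Qed.

Lemma measurable_extra i : measurable_fun setT (extra ^~ i).
Proof.
rewrite /extra; case: insub => [i'|]; first exact: measurable_tnth.
exact: measurable_cst.
Qed.

Lemma bkernel_signed d1 (T : measurableType d1) (y y' : T -> 'I_n -> X)
    (z : T -> nat -> X) (e : {ffun 'I_n -> bool}) i :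
  (forall j, measurable_fun setT (y ^~ j)) ->
  (forall j, measurable_fun setT (y' ^~ j)) ->
  (forall l, measurable_fun setT (z ^~ l)) ->
  bkernel (fun t => signed (y t) (y' t) (z t) shift c pi e i).
Proof.
move=> my my' mz; rewrite /signed; apply: bkernelD.
  by apply: bkernelZ; exact: bkernel_eval.
apply: bkernel_sum => j; apply: bkernelZ; apply: bkernelZ.
by apply: bkernelB; exact: bkernel_eval.
Qed.

Lemma bkernel_centered d1 (T : measurableType d1) B (y : T -> 'I_n -> X) i :
  (forall j, measurable_fun setT (y ^~ j)) ->
  bkernel (fun t => centered B (y t) i).
Proof.
move=> my; rewrite /centered; apply: bkernelB.
  by apply: bkernel_sum => j; apply: bkernelZ; exact: bkernel_eval.
by apply: bkernelZ; exact: bkernel_Eint.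
Qed.

Let e0 : {ffun 'I_n -> bool} := [ffun=> false].
Let unsigned y w := signed y (ghost w) (extra w) shift c pi e0.

Let unsignedE y w i g : unsigned y w i g =
  shift i * g (extra w i) +
  \sum_(j | pi j == i :> nat) (c * g (y j) - c * g (ghost w j)).
Proof.
congr (_ + _); apply: eq_bigr => j _.
by rewrite /e0 ffunE expr0 mul1r mulrBr.
Qed.

Let unsigned_bmf y k d1 (T : measurableType d1) (phi : T -> m.-tuple X)
    (G : T * k.-tuple X -> R) : measurable_fun setT phi -> bmf G ->
  bmf (fun t => multi (unsigned y (phi t)) (fun v => G (t, v))).
Proof.
apply: multi_bmf => i; apply: bkernel_signed => [j|j|l].
- exact: measurable_cst.
- exact: measurable_ghost.
- exact: measurable_extra.
Qed.

Lemma bmf_cons k (f : k.+1.-tuple X -> R) d1 (T : measurableType d1)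
    (p : T -> X) : bmf f -> measurable_fun setT p ->
  bmf (fun q : T * k.-tuple X => f [tuple of p q.1 :: q.2]).
Proof.
move=> bf mp; apply: (bmf_comp _ bf); apply: measurable_cons => //.
exact: measurableT_comp.
Qed.

(** Each integral against [mu] is replaced by averages over fresh points: over
    the ghost copies, to center the evaluations at the points of its color, and
    over one extra point for the remaining mass [shift]. *)
Lemma multi_centered_ghost y k (f : k.-tuple X -> R) : (k <= K)%N -> bmf f ->
  multi (centered finset.set0 y) f =
  \int[tuple_law mu m]_w multi (unsigned y w) f.
Proof.
elim: k f => [|k ih] f kK bf; first by rewrite /= Eint_cst.
pose g w u := multi (unsigned y w) (fun v : k.-tuple X => f [tuple of u :: v]).
pose h u := multi (centered finset.set0 y) (fun v : k.-tuple X => f [tuple of u :: v]).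
have bfu u : bmf (fun v : k.-tuple X => f [tuple of u :: v]).
  by apply: (bmf_comp _ bf); apply: measurable_cons => //; exact: measurable_cst.
have hE u : h u = \int[tuple_law mu m]_w g w u by apply: ih => //; exact: ltnW.
have bg : bmf (fun p : X * m.-tuple X => g p.2 p.1).
  apply: (unsigned_bmf y (phi := snd)
    (G := fun q : (X * m.-tuple X) * k.-tuple X => f [tuple of q.1.1 :: q.2])) => //.
  exact: (bmf_cons bf measurable_fst).
have bgp (p : m.-tuple X -> X) : measurable_fun setT p -> bmf (fun w => g w (p w)).
  move=> mp; apply: (unsigned_bmf y (phi := idfun)
    (G := fun q : m.-tuple X * k.-tuple X => f [tuple of p q.1 :: q.2])) => //.
    exact: measurable_id.
  exact: (bmf_cons bf mp).
have resample (i : 'I_m) :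
    (forall w u l x, (l < k)%N -> unsigned y (tupd w i u) l x = unsigned y w l x) ->
    \int[tuple_law mu m]_w g w (tnth w i) = \int[mu]_u h u.
  move=> ui; rewrite (Eint_resample mu bg); last first.
    by move=> u w u'; apply: eq_multi => l lk x; exact: ui.
  by apply: eq_Rintegral => u _; rewrite hE.
have kK' : (k < K)%N by [].
have hz : \int[tuple_law mu m]_w g w (extra w k) = \int[mu]_u h u.
  rewrite -(resample (rshift n (Ordinal kK'))).
    by apply: eq_Rintegral => w _; rewrite /extra insubT.
  move=> w u l x lk; rewrite !unsignedE; congr (_ * x _ + _).
    rewrite /extra; case: insubP => // i' _ i'l; rewrite tnth_mktuple.
    case: eqP => // /rshift_inj i'k; move: lk; rewrite -i'l i'k /= ltnn//.
  apply: eq_bigr => j _; rewrite /ghost tnth_mktuple.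
  by rewrite eq_lrshift.
have hy j : pi j = k :> nat ->
    \int[tuple_law mu m]_w g w (ghost w j) = \int[mu]_u h u.
  move=> jk; rewrite -(resample (lshift K j))// => w u l x lk.
  rewrite !unsignedE; congr (_ * x _ + _).
    rewrite /extra; case: insubP => // i' _ i'l; rewrite tnth_mktuple.
    by rewrite eq_rlshift.
  apply: eq_bigr => j' /eqP j'l; rewrite /ghost tnth_mktuple.
  case: eqP => // /lshift_inj j'j; move: lk; rewrite -j'l j'j jk ltnn//.
rewrite [LHS]/= -/h /centered.
transitivity (\int[tuple_law mu m]_w (shift k * g w (extra w k) +
   \sum_(j | pi j == k :> nat) (c * g w (y j) - c * g w (ghost w j)))); last first.
  by apply: eq_Rintegral => w _; rewrite /= unsignedE.
have bgy j : bmf (fun w => c * g w (y j)).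
  by apply: bmfZ; apply: bgp; exact: measurable_cst.
have bgz j : bmf (fun w => c * g w (ghost w j)).
  by apply: bmfZ; apply: bgp; exact: measurable_ghost.
have bge : bmf (fun w => g w (extra w k)) by apply: bgp; exact: measurable_extra.
rewrite EintD; [|exact: bmfZ|by apply: bmf_sum => j; exact: bmfB].
rewrite EintZ// hz Eint_sum; last by move=> j; exact: bmfB.
rewrite [in RHS](eq_bigr (fun j => c * h (y j) - c * \int[mu]_u h u)); last first.
  move=> j /eqP jk; rewrite /= EintB// !EintZ ?hE ?hy//.
    by apply: bgp; exact: measurable_ghost.
  by apply: bgp; exact: measurable_cst.
rewrite sumrB /shift mulrBl mulr_suml.
rewrite (eq_bigl (fun j => pi j == k :> nat)); last first.
  by move=> j; rewrite finset.in_set0.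
by ring.
Qed.

End Symmetrization.

Section SymmetrizationInequality.
Context {R : realType} d (X : measurableType d) (mu : probability X R).
Context {n K : nat} (pi : 'I_n -> 'I_K) (b c : R).
Local Notation m := (n + K)%N.
Local Notation Qn := (tuple_law mu n).
Local Notation Qm := (tuple_law mu m).
Local Notation shift := (shift pi b c).

(** Exchanges the entries selected by [e] between the sample and its ghost copy.
    All the resulting tuples have the same law. *)
Let mix (e : {ffun 'I_n -> bool}) (p : n.-tuple X * m.-tuple X) : (n + m).-tuple X :=
  [tuple match fintype.split i with
   | inl j => if e j then ghost p.2 j else tnth p.1 j
   | inr i' => match fintype.split i' with
     | inl j => if e j then tnth p.1 j else ghost p.2 j
     | inr _ => tnth p.2 i'
     end
   end | i < n + m].

Let measurable_mix e : measurable_fun setT (mix e).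
Proof.
have m1 j : measurable_fun setT (fun p : n.-tuple X * m.-tuple X => tnth p.1 j).
  exact: ((measurable_fun_tnthP (@fst (n.-tuple X) (m.-tuple X))).1 measurable_fst j).
have m2 j : measurable_fun setT (fun p : n.-tuple X * m.-tuple X => tnth p.2 j).
  exact: ((measurable_fun_tnthP (@snd (n.-tuple X) (m.-tuple X))).1 measurable_snd j).
apply/measurable_fun_tnthP => i.
rewrite (_ : _ \o _ = fun p : n.-tuple X * m.-tuple X =>
  match fintype.split i with
   | inl j => if e j then ghost p.2 j else tnth p.1 j
   | inr i' => match fintype.split i' with
     | inl j => if e j then tnth p.1 j else ghost p.2 j
     | inr _ => tnth p.2 i'
     end
   end); last by apply/funext => p; rewrite /= tnth_mktuple.
case: fintype.split => [j|i']; first by case: (e j); [exact: m2|exact: m1].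
by case: fintype.split => [j|_]; [case: (e j); [exact: m1|exact: m2]|exact: m2].
Qed.

Let mix_law e A : (forall i, measurable (A i)) ->
  ((Qn \x Qm) (mix e @^-1` rect A) = \prod_(i < n + m) mu (A i))%E.
Proof.
move=> mA.
pose A1 j := if e j then A (rshift n (lshift K j)) else A (lshift m j).
pose A2 i := match fintype.split i with
   | inl j => if e j then A (lshift m j) else A (rshift n (lshift K j))
   | inr _ => A (rshift n i) end.
have mA1 j : measurable (A1 j) by rewrite /A1; case: (e j).
have mA2 i : measurable (A2 i).
  by rewrite /A2; case: fintype.split => // j; case: (e j).
rewrite (_ : _ @^-1` _ = rect A1 `*` rect A2).
  rewrite [LHS]product_measure1E//; [|exact: measurable_rect|exact: measurable_rect].
  transitivity (\prod_(j < n) mu (A1 j) * \prod_(i < m) mu (A2 i))%E.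
    by congr (_ * _)%E; exact: tuple_law_rect.
  rewrite [in RHS]big_split_ord/= !big_split_ord/= !muleA; congr (_ * _)%E.
    rewrite -!big_split/=; apply: eq_bigr => j _.
    rewrite /A1 /A2 (unsplitK (inl j)); case: (e j) => //.
    by rewrite muleC.
  apply: eq_bigr => i _.
  by rewrite /A2 (unsplitK (inr i)).
apply/seteqP; split => -[y w] /= h.
  split => [j|i].
    have := h (lshift m j); have := h (rshift n (lshift K j)).
    rewrite !tnth_mktuple (unsplitK (inl j)) (unsplitK (inr (lshift K j))).
    by rewrite (unsplitK (inl j)) /A1; case: (e j).
  have := h (rshift n i); rewrite tnth_mktuple (unsplitK (inr i)) /A2.
  case: (split_ordP i) => j ij; last by [].
  have := h (lshift m j); rewrite tnth_mktuple (unsplitK (inl j)) /ghost -ij.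
  by case: (e j).
move=> i; rewrite tnth_mktuple; case: (split_ordP i) => [j ->|i' ->].
  have := h.1 j; have := h.2 (lshift K j); rewrite /A1 /A2 (unsplitK (inl j)).
  by case: (e j).
have := h.2 i'; rewrite /A2; case: (split_ordP i') => // j ->.
by have := h.1 j; rewrite /A1; case: (e j).
Qed.

(** Jensen's inequality moves the ghost sample out of the power, and the joint
    law of the sample and its ghost copy is invariant under exchanging any of
    their entries, so that random signs can be inserted. *)
Lemma symmetrization q N (f : 'I_N -> K.-tuple X -> R) (Bd : R) :
  (forall l, bmf (f l)) ->
  (forall y y' z, avg (fun e => \big[Num.max/0]_(l < N)
     ((multi (signed y y' z shift c pi e) (f l) ^+ 2) ^+ q)) <= Bd) ->
  \int[Qn]_y (\big[Num.max/0]_(l < N)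
    ((multi (centered mu pi b c finset.set0 (tnth y)) (f l) ^+ 2) ^+ q)) <= Bd.
Proof.
move=> bf hBd; pose e0 : {ffun 'I_n -> bool} := [ffun=> false].
pose V e (p : n.-tuple X * m.-tuple X) l :=
  (multi (signed (tnth p.1) (ghost p.2) (extra p.2) shift c pi e) (f l) ^+ 2) ^+ q.
pose Phi e p := \big[Num.max/0]_(l < N) V e p l.
have bV e l : bmf (V e ^~ l).
  do 2 apply: bmfX; apply: (multi_bmf (phi := idfun)
    (nu := fun p : n.-tuple X * m.-tuple X =>
      signed (tnth p.1) (ghost p.2) (extra p.2) shift c pi e)
    (G := fun q : (n.-tuple X * m.-tuple X) * K.-tuple X => f l q.2)).
  - move=> i; apply: bkernel_signed => j.
    + exact: ((measurable_fun_tnthP (@fst (n.-tuple X) (m.-tuple X))).1 measurable_fst j).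
    + exact: (measurableT_comp (measurable_ghost _) measurable_snd).
    + exact: (measurableT_comp (measurable_extra _) measurable_snd).
  - exact: measurable_id.
  - exact: (bmf_comp measurable_snd (bf l)).
have bPhi e : bmf (Phi e) by apply: bmf_bigmax => l; exact: bV.
have V0 e p l : 0 <= V e p l by rewrite exprn_ge0// sqr_ge0.
pose Psi (x : (n + m).-tuple X) := Phi e0 ([tuple tnth x (lshift m j) | j < n],
  [tuple tnth x (rshift n i) | i < m]).
have bPsi : bmf Psi.
  apply: (bmf_comp _ (bPhi e0)); apply: measurable_fun_pair;
    apply/measurable_fun_tnthP => i.
    rewrite (_ : _ \o _ = fun x : (n + m).-tuple X => tnth x (lshift m i)).
      exact: measurable_tnth.
    by apply/funext => x; rewrite /= tnth_mktuple.
  rewrite (_ : _ \o _ = fun x : (n + m).-tuple X => tnth x (rshift n i)).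
    exact: measurable_tnth.
  by apply/funext => x; rewrite /= tnth_mktuple.
have PhiE e p : Phi e p = Psi (mix e p).
  apply: eq_bigr => l _; congr ((_ ^+ _) ^+ _); apply: eq_multi => i _ g /=.
  congr (_ * g _ + _).
    rewrite /extra; case: insubP => // i' _ _.
    by rewrite !tnth_mktuple (unsplitK (inr (rshift n i'))) (unsplitK (inr i')).
  apply: eq_bigr => j _; rewrite /ghost !tnth_mktuple.
  rewrite (unsplitK (inl j)) (unsplitK (inr (lshift K j))) (unsplitK (inl j)).
  rewrite /e0 ffunE expr0 mul1r; case: (e j); rewrite ?expr1 ?expr0 ?mul1r//.
  by rewrite mulN1r -mulrN opprB.
have swapI e : \int[(Qn \x Qm)%E]_p Phi e p = \int[(Qn \x Qm)%E]_p Phi e0 p.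
  under eq_Rintegral do rewrite PhiE; under [RHS]eq_Rintegral do rewrite PhiE.
  rewrite (Eint_tuple_law (measurable_mix e) (mix_law e) bPsi).
  by rewrite (Eint_tuple_law (measurable_mix e0) (mix_law e0) bPsi).
apply: (@le_trans _ _ (\int[Qn]_y \int[Qm]_w Phi e0 (y, w))).
  apply: le_Eint.
  - apply: bmf_bigmax => l; do 2 apply: bmfX.
    apply: (multi_bmf (phi := idfun) (nu := fun y : n.-tuple X =>
      centered mu pi b c finset.set0 (tnth y))
      (G := fun q : n.-tuple X * K.-tuple X => f l q.2)).
    + by move=> i; apply: bkernel_centered => j; exact: measurable_tnth.
    + exact: measurable_id.
    + exact: (bmf_comp measurable_snd (bf l)).
  - exact: bmf_Eint.
  - move=> y; have bPy : bmf (fun w => Phi e0 (y, w)).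
      exact: (bmf_comp (measurable_pair1 y) (bPhi e0)).
    apply/bigmax_leP; split.
      apply: Rintegral_ge0 => w _; rewrite /Phi.
      by elim/big_ind: _ => // u v u0 v0; rewrite le_max u0.
    move=> l _; rewrite multi_centered_ghost//.
    apply: le_trans (Eint_jensen _ _ _) _.
      apply: (multi_bmf (phi := idfun) (nu := fun w : m.-tuple X =>
        signed (tnth y) (ghost w) (extra w) shift c pi e0)
        (G := fun q : m.-tuple X * K.-tuple X => f l q.2)).
      + move=> i; apply: bkernel_signed => j.
        * exact: measurable_cst.
        * exact: measurable_ghost.
        * exact: measurable_extra.
      + exact: measurable_id.
      + exact: (bmf_comp measurable_snd (bf l)).
    apply: le_Eint => //; first exact: (bmf_comp (measurable_pair1 y) (bV e0 l)).
    by move=> w; apply: le_bigmax.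
rewrite -Eint_prod//.
have S0 : (0 < #|{: {ffun 'I_n -> bool}}|)%N by apply/card_gt0P; exists e0.
rewrite -(avg_cst (\int[(Qn \x Qm)%E]_p Phi e0 p) S0).
under eq_avg => e do rewrite -(swapI e).
rewrite /avg -Eint_sum// -EintZ; last by apply: bmf_sum.
rewrite -(Eint_cst (Qn \x Qm)%E Bd); apply: le_Eint.
- by apply: bmfZ; exact: bmf_sum.
- exact: bmf_cst.
- by move=> p; exact: hBd.
Qed.

End SymmetrizationInequality.

(** * Off-diagonal integrals as averages over colorings *)

Section OffDiagonal.
Context {R : realType} d (X : measurableType d) (mu : probability X R).

(** The integral of a nonnegative function is a supremum over the simple functions
    below it, which is monotone even without measurability. *)
Lemma le_integral_nonmeasurable (G1 G2 : X -> \bar R) :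
  (forall x, 0 <= G1 x)%E -> (forall x, G1 x <= G2 x)%E ->
  (\int[mu]_x G1 x <= \int[mu]_x G2 x)%E.
Proof.
move=> G10 G12; rewrite !ge0_integralTE//; last first.
  by move=> x; exact: le_trans (G12 x).
apply: le_ereal_sup => _ [h /= hG <-]; exists h => //= x.
exact: le_trans (hG x) (G12 x).
Qed.

(** An integrand that may fail to be measurable on a null set is squeezed
    between two measurable ones. *)
Lemma ge0_integral_off_null (G H : X -> \bar R) (N : set X) :
  measurable N -> mu N = 0%E -> (forall x, 0 <= G x)%E ->
  (forall x, 0 <= H x)%E -> measurable_fun setT H ->
  (forall x, ~ N x -> G x = H x) ->
  (\int[mu]_x G x = \int[mu]_x H x)%E.
Proof.
move=> mN N0 G0 H0 mH GH.
have int_if (a : \bar R) : (0 <= a)%E ->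
    (\int[mu]_x (if x \in N then a else H x) = \int[mu]_x H x)%E.
  move=> a0; apply: ge0_ae_eq_integral => //.
  - apply: measurable_fun_ifT => //.
    by apply: (measurable_fun_bool true); rewrite setTI preimage_mem_true.
  - by move=> x _; case: ifP.
  - exists N; split => // x /= h; apply: contrapT => Nx; apply: h => _.
    by rewrite memNset.
apply/eqP; rewrite eq_le; apply/andP; split.
- rewrite -(int_if +oo%E)//; apply: le_integral_nonmeasurable => // x.
  by case: ifPn => [_|Nx]; rewrite ?leey// GH// => /mem_set; rewrite (negbTE Nx).
- rewrite -(int_if 0%E)//; apply: le_integral_nonmeasurable => x.
    by case: ifP.
  by case: ifPn => // Nx; rewrite GH// => /mem_set; rewrite (negbTE Nx).
Qed.

Lemma Eint_off_null (g h : X -> R) (N : set X) :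
  measurable N -> mu N = 0%E -> bmf h -> (forall x, ~ N x -> g x = h x) ->
  \int[mu]_x g x = \int[mu]_x h x.
Proof.
move=> mN N0 [mh _] gh; rewrite /Rintegral; congr fine.
have mh' : measurable_fun setT (EFin \o h) by exact/measurable_EFinP.
rewrite [LHS]integralE [RHS]integralE; congr (_ - _)%E;
  apply: (@ge0_integral_off_null _ _ N) => //.
- exact: measurable_funepos.
- by move=> x Nx; rewrite !funeposE /= gh.
- exact: measurable_funeneg.
- by move=> x Nx; rewrite !funenegE /= gh.
Qed.

Hypothesis point_null : forall x : X, mu.-negligible [set x].

Lemma Eint_off_finite (l : seq X) (g h : X -> R) : bmf h ->
  (forall x, x \notin l -> g x = h x) -> \int[mu]_x g x = \int[mu]_x h x.
Proof.
move=> bh gh; have [N [mN N0 lN]] : mu.-negligible [set x | x \in l].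
  elim: l {gh} => [|x l ih].
    rewrite (_ : [set _ | _] = set0); first exact: negligible_set0.
    by apply/seteqP; split.
  rewrite (_ : [set _ | _] = [set x] `|` [set y | y \in l]).
    exact: negligibleU.
  apply/seteqP; split => y /=; rewrite inE; first by move=> /predU1P.
  by move=> [->|->]; rewrite ?eqxx ?orbT.
apply: (Eint_off_null mN N0 bh) => x Nx; apply: gh; apply/negP => xl.
exact/Nx/lN.
Qed.

Lemma iterated_integral0 (nu : (X -> R) -> R) k : nu (fun=> 0) = 0 ->
  iterated_integral nu (fun _ : k.-tuple X => 0) = 0.
Proof. by move=> nu0; elim: k => //= k ->. Qed.

(** The list [l] records the points of the outer coordinates, which the induction
    on the number of coordinates has to exclude. *)
Definition avoiding (l : seq X) k (f : k.-tuple X -> R) (v : k.-tuple X) : R :=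
  if uniq v && all (fun x => x \notin l) v then f v else 0.

Lemma avoiding_cons l k (f : k.+1.-tuple X -> R) u (v : k.-tuple X) :
  avoiding l f [tuple of u :: v] =
  if u \in l then 0
  else avoiding (u :: l) (fun v => f [tuple of u :: v]) v.
Proof.
have allE : all (fun x => x \notin u :: l) v =
    (u \notin v) && all (fun x => x \notin l) v.
  rewrite (@eq_all _ _ (predI (predC1 u) (fun x => x \notin l))).
    by rewrite all_predI -has_pred1 -all_predC.
  by move=> x /=; rewrite inE negb_or.
rewrite /avoiding allE /=; case: (u \in l); rewrite ?andbF//=.
by congr (if _ then _ else _); rewrite -andbA [in RHS]andbCA.
Qed.

Section colors.
Context {n K : nat} (K0 : (0 < K)%N) (y : 'I_n -> X) (y_inj : injective y).

Let emp (g : X -> R) := empirical_integral y g - \int[mu]_x g x.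
Let c : R := K%:R / n%:R.
Let used (l : seq X) : {set 'I_n} := finset.finset (fun j => y j \in l).
Let cen (B : {set 'I_n}) (pi : {ffun 'I_n -> 'I_K}) := centered mu pi 1 c B y.

Let cen_bmf B pi k d1 (T : measurableType d1) (G : T * k.-tuple X -> R) :
  bmf G -> bmf (fun t => multi (cen B pi) (fun v => G (t, v))).
Proof.
move=> bG; apply: (multi_bmf (phi := idfun) (nu := fun=> cen B pi)) => //.
  by move=> i; apply: bkernel_centered => j; exact: measurable_cst.
exact: measurable_id.
Qed.

(** A coloring assigns to each index the only coordinate where it may occur.
    Averaged over the colorings, an index of the color [k] has weight
    [c / K = 1 / n], and distinct coordinates use distinct indices. *)
Lemma iterated_integral_coloring k (f : k.-tuple X -> R) (l : seq X) :
  (k <= K)%N -> bmf f ->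
  iterated_integral emp (avoiding l f) = avg (fun pi => multi (cen (used l) pi) f).
Proof.
have C0 : (0 < #|{: {ffun 'I_n -> 'I_K}}|)%N.
  by apply/card_gt0P; exists [ffun=> Ordinal K0].
elim: k f l => [|k ih] f l kK bf; first by rewrite /= avg_cst// /avoiding.
pose g pi B u := multi (cen B pi) (fun v : k.-tuple X => f [tuple of u :: v]).
pose A u := iterated_integral emp (fun v : k.-tuple X => avoiding l f [tuple of u :: v]).
have bg pi B : bmf (g pi B).
  apply: (@cen_bmf B pi k _ X (fun q => f [tuple of q.1 :: q.2])).
  exact: (bmf_cons (p := fun u : X => u) bf (@measurable_id _ X setT)).
have emp0 : emp (fun=> 0) = 0.
  by rewrite /emp /empirical_integral Eint_cst big1// mulr0 subr0.
have A_in u : u \in l -> A u = 0.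
  move=> ul; rewrite /A (_ : (fun v => _) = fun=> 0); first exact: iterated_integral0.
  by apply/funext => v; rewrite avoiding_cons ul.
have A_out u : u \notin l -> A u = avg (fun pi => g pi (used (u :: l)) u).
  move=> ul; rewrite /A (_ : (fun v => _) =
      avoiding (u :: l) (fun v : k.-tuple X => f [tuple of u :: v])).
    apply: ih; first exact: ltnW.
    by apply: (bmf_comp _ bf); apply: measurable_cons => //; exact: measurable_cst.
  by apply/funext => v; rewrite avoiding_cons (negbTE ul).
have intA : \int[mu]_u A u = avg (fun pi => \int[mu]_u g pi (used l) u).
  rewrite /avg -Eint_sum// -EintZ; last exact: bmf_sum.
  apply: (@Eint_off_finite (l ++ codom y)).
    by apply: bmfZ; exact: bmf_sum.
  move=> u; rewrite mem_cat negb_or => /andP[ul uy]; rewrite A_out//.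
  apply: eq_avg => pi; congr (g pi _ u); apply/setP => j; rewrite !inE.
  by case: eqP => // yj; move: uy; rewrite -yj codom_f.
have weight j : j \notin used l ->
    avg (fun pi : {ffun 'I_n -> 'I_K} =>
      if pi j == k :> nat then c * g pi (used l) (y j) else 0) =
    n%:R^-1 * A (y j).
  rewrite inE => yl; rewrite A_out//; set B := used (y j :: l).
  transitivity (avg (fun pi : {ffun 'I_n -> 'I_K} =>
      if pi j == k :> nat then c * g pi B (y j) else 0)).
    apply: eq_avg => pi; case: eqP => // jk; congr (_ * _).
    apply: eq_multi => i ik h; congr (_ - _); apply: eq_bigl => j'.
    rewrite !inE (inj_eq y_inj) negb_or.
    by case: (eqVneq j' j) => [->|_] //=; rewrite jk (gtn_eqF ik) andbF.
  rewrite (@avg_resample R 'I_n 'I_K j (fun a pi =>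
      if a == k :> nat then c * g pi B (y j) else 0)) ?card_ord//; last first.
    move=> a pi a'; case: eqP => // _; congr (_ * _).
    apply: eq_multi => i ik h; congr (_ - _); apply: eq_bigl => j'.
    by rewrite /fupd ffunE; case: (eqVneq j' j) => // ->; rewrite inE mem_head.
  rewrite -avgZl; apply: eq_avg => pi.
  rewrite /avg card_ord (bigD1 (Ordinal kK))//= eqxx big1 => [|a ak]; last first.
    by case: eqP => // e; case/eqP: ak; apply/val_inj.
  rewrite addr0 mulrA /c mulrA mulVf ?mul1r// pnatr_eq0 -lt0n//.
rewrite [LHS]/= /emp intA /empirical_integral -/A.
transitivity (avg (fun pi : {ffun 'I_n -> 'I_K} =>
   \sum_(j | j \notin used l) (if pi j == k :> nat
      then c * g pi (used l) (y j) else 0) - \int[mu]_u g pi (used l) u)).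
  rewrite avgB; congr (_ - _); rewrite avg_sum (eq_bigr _ weight) -mulr_sumr.
  congr (_ * _); rewrite [RHS]big_mkcond; apply: eq_bigr => j _.
  by rewrite inE; case: ifPn => // /negPn; exact: A_in.
by apply: eq_avg => pi; rewrite /= /cen /centered mul1r -big_mkcondr.
Qed.

(** The factors leave the inner integrals because the integrands are measurable. *)
Lemma multi_centered_scale (a b c' : R) (pi : {ffun 'I_n -> 'I_K}) k
    (f : k.-tuple X -> R) : bmf f ->
  multi (centered mu pi (a * b) (a * c') finset.set0 y) f =
  a ^+ k * multi (centered mu pi b c' finset.set0 y) f.
Proof.
elim: k f => [|k ih] f bf; first by rewrite expr0 mul1r.
pose h u := multi (centered mu pi b c' finset.set0 y)
  (fun v : k.-tuple X => f [tuple of u :: v]).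
have bh : bmf h.
  apply: (multi_bmf (phi := idfun) (nu := fun=> centered mu pi b c' finset.set0 y)
    (G := fun q : X * k.-tuple X => f [tuple of q.1 :: q.2])).
  - by move=> i; apply: bkernel_centered => j; exact: measurable_cst.
  - exact: measurable_id.
  - exact: (bmf_cons (p := fun u : X => u) bf (@measurable_id _ X setT)).
rewrite /= (_ : (fun u => _) = fun u => a ^+ k * h u); last first.
  apply/funext => u; apply: ih.
  by apply: (bmf_comp _ bf); apply: measurable_cons => //; exact: measurable_cst.
rewrite -/h /centered EintZ// exprS [RHS]mulrBr mulr_sumr.
by congr (_ - _); [apply: eq_bigr => j _|]; ring.
Qed.

End colors.
End OffDiagonal.

(** * Non-atomic measures *)

Section NonAtomic.
Context {R : realType}.

Lemma negligible_le_eps d' (T : measurableType d') (P : {measure set T -> \bar R})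
    (A : set T) :
  (forall eps : R, 0 < eps -> exists N, [/\ measurable N, A `<=` N &
     (P N <= eps%:E)%E]) -> P.-negligible A.
Proof.
move=> h; have /choice[N hN] : forall k : nat, exists N, [/\ measurable N, A `<=` N &
    (P N <= (k.+1%:R^-1)%:E)%E] by move=> k; apply: h; rewrite invr_gt0.
have mN : measurable (\bigcap_k N k) by apply: bigcapT_measurable => k; case: (hN k).
exists (\bigcap_k N k); split => //; last first.
  by move=> x Ax k _; case: (hN k) => _ + _; apply.
apply/eqP; rewrite eq_le measure_ge0 andbT; apply/lee_addgt0Pr => e e0.
rewrite add0e; pose k := Num.truncn e^-1.
have [mk _ hk] := hN k.
apply: (@le_trans _ _ (P (N k))).
  by apply: le_measure; rewrite ?inE// => x; apply.
apply: le_trans hk _; rewrite lee_fin invf_ple ?posrE//.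
by rewrite ltW// truncnS_gt.
Qed.

Context d (X : measurableType d) (mu : probability X R) (na : non_atomic mu).
Implicit Types A B C : set X.

Let m A : R := fine (mu A).

Let muE A : measurable A -> mu A = (m A)%:E.
Proof. by move=> mA; rewrite fineK// fin_num_measure. Qed.

Let m_ge0 A : 0 <= m A. Proof. by rewrite fine_ge0. Qed.

Let mD A B : measurable A -> measurable B -> B `<=` A -> m (A `\` B) = m A - m B.
Proof.
move=> mA mB BA; have : mu A = (mu (A `\` B) + mu B)%E.
  by have := measureDI mu mA mB; rewrite (setIidr BA).
rewrite !muE//; last exact: measurableD.
by rewrite -EFinD => -[->]; rewrite addrK.
Qed.

Let m_le1 A : measurable A -> m A <= 1.
Proof. by move=> mA; rewrite -lee_fin -muE// probability_le1. Qed.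

(** One of the two parts into which non-atomicity splits a set has at most half of
    its measure. *)
Lemma non_atomic_small A (eps : R) : measurable A -> 0 < m A -> 0 < eps ->
  exists B, [/\ measurable B, B `<=` A, 0 < m B & m B <= eps].
Proof.
move=> mA A0 eps0.
have H (i : nat) : exists B, [/\ measurable B, B `<=` A, 0 < m B &
    2 ^+ i * m B <= 1].
  elim: i => [|i [B [mB BA B0 hB]]].
    by exists A; split => //; rewrite expr0 mul1r m_le1.
  have [C [mC CB C0 hC]] : exists C, [/\ measurable C, C `<=` B, 0 < m C & m C < m B].
    have B0' : (0 < mu B)%E by rewrite muE.
    have [C [mC CB C0 CltB]] := na mB B0'.
    have C0' : (0 < mu C)%E := C0; have CltB' : (mu C < mu B)%E := CltB.
    by exists C; rewrite -!lte_fin -!muE.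
  have e := mD mB mC CB.
  have [h|h] := leP (2 * m C) (m B).
    exists C; split => //; first exact: subset_trans BA.
    by rewrite exprSr -mulrA (le_trans _ hB)// ler_wpM2l// exprn_ge0.
  exists (B `\` C); split.
  - exact: measurableD.
  - by apply: subset_trans BA => x [].
  - by rewrite e subr_gt0.
  - rewrite exprSr -mulrA (le_trans _ hB)// ler_wpM2l ?exprn_ge0// e.
    by lra.
have [B [mB BA B0 hB]] := H (Num.truncn eps^-1).+1.
exists B; split => //; rewrite -(@ler_pM2l _ (2 ^+ (Num.truncn eps^-1).+1)) ?exprn_gt0//.
apply: (le_trans hB); rewrite -ler_pdivrMr// mul1r.
apply: (@le_trans _ _ (Num.truncn eps^-1).+1%:R); first by rewrite ltW// truncnS_gt.
by rewrite -natrX ler_nat ltnW// ltn_expl.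
Qed.

(** Greedy exhaustion: each step removes from the rest a set of measure at most
    [eps], and at least half as large as possible.  A rest of positive measure
    would contain a small set of positive measure, whose size bounds from below
    infinitely many disjoint removed sets. *)
Lemma non_atomic_partition (eps : R) : 0 < eps ->
  exists (B : nat -> set X) (N : set X), [/\ forall i, measurable (B i),
    measurable N, trivIset setT B, forall x, N x \/ exists i, B i x &
    mu N = 0%E /\ forall i, (mu (B i) <= eps%:E)%E].
Proof.
move=> eps0.
have /choice[pick hpick] : forall A, exists B, measurable A ->
    [/\ measurable B, B `<=` A, m B <= eps &
      forall C, measurable C -> C `<=` A -> m C <= eps -> m C <= 2 * m B].
  move=> A; have [mA|nA] := pselect (measurable A); last by exists set0.
  pose S := [set m C | C in [set C | [/\ measurable C, C `<=` A & m C <= eps]]].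
  have S0 : S 0 by exists set0; [split => //|]; rewrite /m measure0//= ltW.
  have hS : has_sup S.
    by split; [exists 0|exists eps => _ [C [_ _ hC] <-]].
  have ub C : measurable C -> C `<=` A -> m C <= eps -> m C <= sup S.
    by move=> mC CA hC; apply: sup_ubound; [exact: hS.2|exists C].
  have [s0|s0] := leP (sup S) 0.
    exists set0 => _; split => //; first by rewrite /m measure0//= ltW.
    by move=> C mC CA hC; rewrite /m measure0 mulr0 (le_trans _ s0)//; exact: ub.
  have s20 : 0 < sup S / 2 by rewrite divr_gt0.
  have [_ [B [mB BA hB] <-] lB] := sup_adherent s20 hS.
  exists B => _; split => // C mC CA hC; apply: le_trans (ub C mC CA hC) _.
  by lra.
pose rest := fix rest i := if i is i'.+1 then rest i' `\` pick (rest i') else setT.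
have mrest i : measurable (rest i).
  elim: i => [|i ih] //=; apply: measurableD => //.
  by case: (hpick _ ih).
pose B i := pick (rest i).
have hB i := hpick _ (mrest i).
have mB i : measurable (B i) by case: (hB i).
have rest_le i j : (i <= j)%N -> rest j `<=` rest i.
  move=> /subnK <-; elim: (j - i)%N => [//|k ih] x [/ih]; exact.
pose N := \bigcap_i rest i.
have mN : measurable N by exact: bigcapT_measurable.
have N0 : m N <= 0.
  rewrite leNgt; apply/negP => N0.
  have [C [mC CN C0 Ceps]] := non_atomic_small mN N0 eps0.
  have Bi i : m C <= 2 * m (B i).
    case: (hB i) => _ _ _; apply => //.
    by apply: subset_trans CN _; exact: bigcap_inf.
  have mr i : m (rest i) <= 1 - i%:R * (m C / 2).
    elim: i => [|i ih]; first by rewrite mul0r subr0 m_le1.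
    rewrite /= mD//; [|exact: mB|by case: (hB i)].
    by have := Bi i; rewrite -/(B i) -[i.+1%:R]natr1 mulrDl; lra.
  pose k := (Num.truncn (m C / 2)^-1).+1.
  have := le_trans (m_ge0 _) (mr k); apply/negP; rewrite -ltNge subr_lt0.
  by rewrite -ltr_pdivrMr ?divr_gt0// mul1r truncnS_gt.
exists B, N; split => //.
- apply: ltn_trivIset => i j ij; apply/seteqP; split => x //= -[xi xj].
  case: (hB i) => _ /(_ x xj) + _ _; move=> /(rest_le _ _ ij) [_]; exact.
- move=> x; have [Nx|/existsNP[i hi]] := pselect (forall i, rest i x).
    by left => i _.
  right; elim: i hi => [|i ih] hi; first by case: hi.
  have [ri|ri] := pselect (rest i x); last exact: ih.
  exists i; apply: contrapT => Bx; exact: hi.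
- split; last by move=> i; rewrite muE// lee_fin; case: (hB i).
  by rewrite muE//; congr EFin; apply/le_anti; rewrite N0 m_ge0.
Qed.

Lemma non_atomic_point x : mu.-negligible [set x].
Proof.
apply: negligible_le_eps => eps eps0.
have [B [N [mB mN _ cov [N0 hB]]]] := non_atomic_partition eps0.
have [Nx|[i Bx]] := cov x.
  have hN : (mu N <= eps%:E)%E by rewrite N0 lee_fin ltW.
  by exists N; split => // _ ->.
by exists (B i); split => [//|_ -> //|]; exact: hB.
Qed.

(** The diagonal is covered by the squares of the cells of a fine partition. *)
Lemma non_atomic_diagonal d' (T : measurableType d') (P : probability T R)
    (xi1 xi2 : T -> X) :
  measurable_fun setT xi1 -> measurable_fun setT xi2 ->
  (forall A B, measurable A -> measurable B ->
    P (xi1 @^-1` A `&` xi2 @^-1` B) = (mu A * mu B)%E) ->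
  P.-negligible [set w | xi1 w = xi2 w].
Proof.
move=> m1 m2 ind; apply: negligible_le_eps => eps eps0.
have [B [N [mB mN tB cov [N0 hB]]]] := non_atomic_partition eps0.
pose F i := xi1 @^-1` B i `&` xi2 @^-1` B i.
have mpre (f : T -> X) A : measurable_fun setT f -> measurable A ->
    measurable (f @^-1` A).
  by move=> mf mA; rewrite -[_ @^-1` _]setTI; exact: mf.
have mF i : measurable (F i) by apply: measurableI; exact: mpre.
have mUF : measurable (\bigcup_i F i) by exact: bigcup_measurable.
have m1N : measurable (xi1 @^-1` N) by exact: mpre.
have PN : P (xi1 @^-1` N) = 0%E.
  have := ind N setT mN measurableT.
  by rewrite preimage_setT setIT N0 mul0e.
exists (xi1 @^-1` N `|` \bigcup_i F i); split.
- exact: measurableU.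
- move=> w /= e; have [Nx|[i Bx]] := cov (xi1 w); first by left.
  by right; exists i => //; split => //=; rewrite -e.
- apply: (@le_trans _ _ (P (xi1 @^-1` N) + P (\bigcup_i F i))%E).
    exact: measureU2.
  rewrite PN add0e.
  apply: (@le_trans _ _ (\sum_(i <oo) P (F i))%E).
    by apply: measure_sigma_subadditive.
  apply: (@le_trans _ _ (\sum_(i <oo) eps%:E * mu (B i))%E).
    apply: lee_nneseries => // i _; rewrite ind//.
    by apply: lee_wpmul2r.
  rewrite nneseriesZl//.
  apply: (@le_trans _ _ (eps%:E * 1)%E); last by rewrite mule1.
  apply: lee_wpmul2l; first by rewrite lee_fin ltW.
  apply: (@le_trans _ _ (mu (\bigcup_i B i))).
    have mUB : measurable (\bigcup_i B i) by exact: bigcup_measurable.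
    have /cvg_lim h := @measure_semi_sigma_additive _ _ _ mu B mB tB mUB.
    by rewrite -[leRHS]h.
  by apply: probability_le1; exact: bigcup_measurable.
Qed.

End NonAtomic.

(** * Moments of the supremum *)

(** The factor [64] of [chaining] times the factor [132] of the moments of
    [color_mass]. *)
Definition moment_constant (R : realType) (K : nat) : R := 8448 * K%:R ^+ 3.

Lemma moment_constant_gt0 (R : realType) (K : nat) : (0 < K)%N ->
  0 < moment_constant R K.
Proof.
by move=> K0; apply: mulr_gt0; [rewrite ltr0n|rewrite exprn_gt0// ltr0n].
Qed.

Section MomentBound.
Context {R : realType} d (X : measurableType d) (mu : probability X R).
Context {n K : nat} (n0 : (0 < n)%N) (K0 : (0 < K)%N).
Let b : R := Num.sqrt n%:R.
Let c : R := K%:R / b.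

Let b0 : 0 < b. Proof. by rewrite sqrtr_gt0 ltr0n. Qed.
Let b2 : b ^+ 2 = n%:R. Proof. by rewrite sqr_sqrtr. Qed.
Let c0 : 0 < c. Proof. by rewrite divr_gt0// ltr0n. Qed.
Let c2n : c ^+ 2 * n%:R = K%:R ^+ 2.
Proof. by rewrite /c -b2 expr_div_n divfK// gt_eqF// exprn_gt0. Qed.

(** The total mass of [energy], which depends on the coloring but not on the
    points. *)
Definition color_mass (q : nat) (pi : 'I_n -> 'I_K) (i : nat) : R :=
  shift pi b c i ^+ 2 + 128 * q%:R * c ^+ 2 * (\sum_(j | pi j == i :> nat) 1).

Let count_le (pi : 'I_n -> 'I_K) (i : nat) :
  0 <= (\sum_(j | pi j == i :> nat) 1 : R) <= n%:R.
Proof.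
rewrite sumr_ge0//=; apply: (@le_trans _ _ (\sum_(j < n) 1)).
  by rewrite [leLHS]big_mkcond/=; apply: ler_sum => j _; case: ifP; rewrite ?lexx ?ler01.
by rewrite sumr_const card_ord.
Qed.

Lemma color_mass_gt0 q pi i : (0 < q)%N -> 0 < color_mass q pi i.
Proof.
move=> q0; rewrite /color_mass /shift.
have -> : \sum_(j | pi j == i :> nat) c = c * \sum_(j | pi j == i :> nat) 1.
  by rewrite mulr_sumr; apply: eq_bigr => j _; rewrite mulr1.
have /andP[] := count_le pi i; set S := \sum_(_ | _) 1.
rewrite le_eqVlt => /predU1P[<- _|S0 _].
  by rewrite !mulr0 addr0 sub0r sqrrN exprn_gt0.
rewrite ltr_wpDl ?sqr_ge0// mulr_gt0// mulr_gt0 ?exprn_gt0//.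
by rewrite mulr_gt0// ltr0n.
Qed.

Lemma color_mass_le q pi i :
  color_mass q pi i <= shift pi b c i ^+ 2 + 128 * q%:R * K%:R ^+ 2.
Proof.
rewrite lerD2l -c2n mulrA; apply: ler_wpM2l.
  by rewrite mulr_ge0 ?sqr_ge0// mulr_ge0.
by have /andP[] := count_le pi i.
Qed.

(** At a fixed sample the randomness is in the signs only, and the chaos
    moments of [chaos_moment] feed the chaining argument. *)
Lemma signed_sup_moment (D L : R) (G : set (K.-tuple X -> R)) (pi : 'I_n -> 'I_K)
    y y' z (q N : nat) (f : 'I_N -> K.-tuple X -> R) :
  L2_dense D L G -> (forall g, G g -> forall v, `|g v| <= 1) ->
  (0 < q)%N -> 2 * L <= q%:R -> (forall l, G (f l)) ->
  avg (fun e => \big[Num.max/0]_(l < N)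
     ((multi (signed y y' z (shift pi b c) c pi e) (f l) ^+ 2) ^+ q)) <=
  (`|D| + D ^+ 2 * 8 `^ L + 1) * (64 * \prod_(i < K) color_mass q pi i) ^+ q.
Proof.
move=> dG G1 q0 qL Gf.
pose en := energy y y' z (shift pi b c) c pi q.
have [i|s hs] := @multi_discrete R X en K.
  exists ((shift pi b c i ^+ 2, z i) ::
    [seq (64 * q%:R * c ^+ 2, y j) | j <- enum 'I_n & pi j == i :> nat] ++
    [seq (64 * q%:R * c ^+ 2, y' j) | j <- enum 'I_n & pi j == i :> nat]) => g.
  rewrite big_cons big_cat !big_map !big_filter !big_enum_cond/=.
  rewrite ger0_norm ?sqr_ge0// /en /energy -big_split/=; congr (_ + _).
  apply: eq_bigr => j _; rewrite ger0_norm; first by ring.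
  by rewrite mulr_ge0 ?sqr_ge0// mulr_ge0.
have mE : \prod_(i < K) color_mass q pi i = \sum_(r <- s) `|r.1|.
  have := hs (fun=> 1); rewrite multi_cst; last by move=> i; exact: energy_linear.
  under [RHS]eq_bigr do rewrite mulr1; move=> <-.
  apply: eq_bigr => i _; rewrite /en /energy mulr1; congr (_ + _).
  by rewrite mulr_sumr; apply: eq_bigr => j _; ring.
rewrite mE; apply: (@chaining R _ _ D L G s _ (fun e g =>
  multi (signed y y' z (shift pi b c) c pi e) g) q N f dG G1) => //.
- by rewrite -mE prodr_gt0// => i _; exact: color_mass_gt0.
- by move=> e a g h; apply: multi_linear => i; exact: signed_linear.
- by move=> g; rewrite -(hs (fun v => g v ^+ 2)); exact: chaos_moment.
Qed.

(** The shift is a sum over the indices of independent centered variables. *)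
Lemma shift_moment q i : (0 < q)%N -> (i < K)%N ->
  avg (fun pi : {ffun 'I_n -> 'I_K} => (shift pi b c i ^+ 2) ^+ q) <=
  (4 * q%:R * K%:R ^+ 2) ^+ q.
Proof.
move=> q0 iK; pose xi (a : 'I_K) : R := (if a == i :> nat then K%:R else 0) - 1.
have := @avg_centered_sum R 'I_n 'I_K xi K%:R q (enum 'I_n) (fun=> 0)
  (fun _ _ => b^-1) 0 (fun=> b^-1 ^+ 2).
have -> : \sum_(j <- enum 'I_n) b^-1 ^+ 2 = 1.
  rewrite big_enum/= sumr_const card_ord -mulr_natr -b2 -exprMn mulVf ?expr1n//.
  by rewrite gt_eqF.
rewrite add0r mulr1 => H.
rewrite (_ : avg _ = avg (fun pi : {ffun 'I_n -> 'I_K} =>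
    ((0 + \sum_(j <- enum 'I_n) xi (pi j) * b^-1) ^+ 2) ^+ q)).
  have C0 : (0 < #|{: {ffun 'I_n -> 'I_K}}|)%N.
    by apply/card_gt0P; exists [ffun=> Ordinal iK].
  apply: H => //.
  - by rewrite card_ord.
  - rewrite /xi sumrB sumr_const card_ord (bigD1 (Ordinal iK))//= eqxx.
    rewrite big1 ?addr0 ?subrr//.
    by move=> a ai; case: eqP => // e; case/eqP: ai; apply/val_inj.
  - move=> a a'; rewrite /xi opprB addrA subrK.
    by do 2 case: ifP => _; rewrite ?subrr ?subr0 ?sub0r ?normrN ?normr0 ?normr_nat.
  - exact: enum_uniq.
  - by move=> _; rewrite exprn_ge0// invr_ge0 ltW.
  - by rewrite /= avg_cst// expr0n.
  - by move=> j _; rewrite /= avg_cst.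
apply: eq_avg => pi; congr ((_ ^+ _) ^+ _).
rewrite add0r big_enum/= /xi -mulr_suml sumrB sumr_const card_ord mulrBl.
by rewrite -big_mkcond/= mulr_suml -b2 expr2 mulfK ?gt_eqF.
Qed.

Lemma prod_le_sum_expr (x : 'I_K -> R) q : (forall i, 0 <= x i) ->
  (\prod_(i < K) x i) ^+ q <= \sum_(i < K) x i ^+ (K * q).
Proof.
move=> x0; have [i _ hi] := @arg_maxP _ R 'I_K (Ordinal K0) xpredT x isT.
apply: (@le_trans _ _ (x i ^+ (K * q))); last first.
  by rewrite (bigD1 i)//= lerDl sumr_ge0// => j _; rewrite exprn_ge0.
rewrite exprM; apply: ler_exprn; first by rewrite prodr_ge0.
rewrite -[X in _ ^+ X]card_ord -prodr_const; apply: ler_prod => j _.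
by rewrite x0/=; exact: hi.
Qed.

(** The largest factor dominates the product, and by Minkowski's inequality its
    moments of order [K q] cost one factor of order [q] for each color. *)
Lemma color_mass_moment q : (0 < q)%N ->
  avg (fun pi : {ffun 'I_n -> 'I_K} => (64 * \prod_(i < K) color_mass q pi i) ^+ q) <=
  K%:R * (moment_constant R K * q%:R) ^+ (K * q).
Proof.
move=> q0; have Kq0 : (0 < K * q)%N by rewrite muln_gt0 K0.
have K1 : 1 <= K%:R :> R by rewrite ler1n.
have h i : (i < K)%N -> avg (fun pi : {ffun 'I_n -> 'I_K} =>
    color_mass q pi i ^+ (K * q)) <= (132 * K%:R ^+ 3 * q%:R) ^+ (K * q).
  move=> iK; apply: (@le_trans _ _ (avg (fun pi : {ffun 'I_n -> 'I_K} =>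
      (shift pi b c i ^+ 2 + 128 * q%:R * K%:R ^+ 2) ^+ (K * q)))).
    apply: ler_avg => pi; apply: ler_exprn; last exact: color_mass_le.
    by rewrite ltW// color_mass_gt0.
  apply: (@le_trans _ _ ((4 * (K * q)%:R * K%:R ^+ 2 +
      128 * q%:R * K%:R ^+ 2) ^+ (K * q))).
    have e1 : 0 <= 4 * (K * q)%:R * K%:R ^+ 2 :> R.
      by rewrite mulr_ge0 ?sqr_ge0// mulr_ge0.
    have e2 : 0 <= 128 * q%:R * K%:R ^+ 2 :> R.
      by rewrite mulr_ge0 ?sqr_ge0// mulr_ge0.
    apply: (avg_minkowski Kq0 _ _ e1 e2) => [pi|//||].
    - exact: sqr_ge0.
    - exact: shift_moment.
    - by rewrite avg_cst//; apply/card_gt0P; exists [ffun=> Ordinal K0].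
  apply: ler_exprn.
    by rewrite addr_ge0// mulr_ge0 ?sqr_ge0// mulr_ge0.
  rewrite natrM; have : K%:R ^+ 2 * q%:R <= K%:R ^+ 3 * q%:R :> R.
    by rewrite ler_wpM2r// [leRHS]exprS ler_peMl// exprn_ge0.
  rewrite (_ : 4 * (K%:R * q%:R) * K%:R ^+ 2 = 4 * (K%:R ^+ 3 * q%:R)); last by ring.
  by rewrite -mulrA [q%:R * _]mulrC -[132 * _ * _]mulrA; lra.
apply: (@le_trans _ _ (64 ^+ (K * q) * (\sum_(i < K)
    avg (fun pi : {ffun 'I_n -> 'I_K} => color_mass q pi i ^+ (K * q))))).
  rewrite -avg_sum -avgZl; apply: ler_avg => pi; rewrite exprMn.
  apply: ler_pM.
  - by rewrite exprn_ge0.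
  - by rewrite exprn_ge0// prodr_ge0// => i _; rewrite ltW// color_mass_gt0.
  - by apply: ler_weXn2l; rewrite ?ler1n// leq_pmull.
  - by apply: prod_le_sum_expr => i; rewrite ltW// color_mass_gt0.
apply: (@le_trans _ _ (64 ^+ (K * q) * (\sum_(i < K)
    (132 * K%:R ^+ 3 * q%:R) ^+ (K * q)))).
  by rewrite ler_wpM2l ?exprn_ge0//; apply: ler_sum => i _; exact: h.
rewrite sumr_const card_ord -[X in _ * X <= _]mulr_natl mulrCA -exprMn ler_wpM2l//.
by rewrite /moment_constant !mulrA (_ : 64 * 132 = 8448 :> R)//; ring.
Qed.

(** The entropy of the class enters only through a factor that does not grow with
    [q]. *)
Lemma sup_moment (D L : R) (G : set (K.-tuple X -> R)) (q N : nat)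
    (f : 'I_N -> K.-tuple X -> R) :
  L2_dense D L G -> (forall g, G g -> forall v, `|g v| <= 1) ->
  (0 < q)%N -> 2 * L <= q%:R -> (forall l, G (f l)) ->
  \int[tuple_law mu n]_y (\big[Num.max/0]_(l < N)
    ((avg (fun pi : {ffun 'I_n -> 'I_K} =>
        multi (centered mu pi b c finset.set0 (tnth y)) (f l)) ^+ 2) ^+ q)) <=
  (`|D| + D ^+ 2 * 8 `^ L + 1) * (K%:R * (moment_constant R K * q%:R) ^+ (K * q)).
Proof.
move=> dG G1 q0 qL Gf; set C := (_ + _ + 1).
have C0 : 0 <= C by rewrite addr_ge0// addr_ge0// mulr_ge0 ?sqr_ge0// powR_ge0.
have bf l : bmf (f l).
  by split; [exact: dG.1|exists 1 => v; exact: G1].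
pose V (pi : {ffun 'I_n -> 'I_K}) l (y : n.-tuple X) :=
  multi (centered mu pi b c finset.set0 (tnth y)) (f l).
have bV pi l : bmf (V pi l).
  apply: (multi_bmf (phi := idfun) (nu := fun y : n.-tuple X =>
    centered mu pi b c finset.set0 (tnth y))
    (G := fun q : n.-tuple X * K.-tuple X => f l q.2)).
  + by move=> i; apply: bkernel_centered => j; exact: measurable_tnth.
  + exact: measurable_id.
  + exact: (bmf_comp measurable_snd (bf l)).
have card0 : (0 < #|{: {ffun 'I_n -> 'I_K}}|)%N.
  by apply/card_gt0P; exists [ffun=> Ordinal K0].
pose W (pi : {ffun 'I_n -> 'I_K}) y := \big[Num.max/0]_(l < N) ((V pi l y ^+ 2) ^+ q).
have bW pi : bmf (W pi) by apply: bmf_bigmax => l; do 2 apply: bmfX.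
have W0 pi y : 0 <= W pi y.
  by rewrite /W; elim/big_ind: _ => // [u v u0 _|l _];
    rewrite ?le_max ?u0// exprn_ge0// sqr_ge0.
have bavg (F : {ffun 'I_n -> 'I_K} -> n.-tuple X -> R) : (forall pi, bmf (F pi)) ->
    bmf (fun y => avg (fun pi => F pi y)).
  by move=> bF; apply: bmfZ; exact: bmf_sum.
apply: (@le_trans _ _ (\int[tuple_law mu n]_y avg (fun pi => W pi y))).
  apply: le_Eint.
  - by apply: bmf_bigmax => l; do 2 apply: bmfX; apply: bavg => pi; exact: bV.
  - exact: bavg.
  - move=> y; apply/bigmax_leP; split; first by apply: avg_ge0 => pi.
    move=> l _; apply: le_trans (avg_expr_even _ _ card0) _.
    by apply: ler_avg => pi; exact: (le_bigmax _ (fun l => (V pi l y ^+ 2) ^+ q)).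
apply: (@le_trans _ _ (avg (fun pi : {ffun 'I_n -> 'I_K} =>
    C * (64 * \prod_(i < K) color_mass q pi i) ^+ q))).
  rewrite /avg EintZ; last exact: bmf_sum.
  rewrite Eint_sum// ler_wpM2l ?invr_ge0//; apply: ler_sum => pi _.
  apply: symmetrization => // y y' z.
  exact: (signed_sup_moment pi y y' z dG G1 q0 qL Gf).
by rewrite avgZl ler_wpM2l// color_mass_moment.
Qed.

End MomentBound.

(** * Tail of the supremum *)

Section TailBound.
Context {R : realType} d (X : measurableType d) (mu : probability X R).
Context dO (Omega : measurableType dO) (P : probability Omega R).
Context {n k : nat} (n0 : (0 < n)%N) (k0 : (0 < k)%N).
Variable xi : 'I_n -> {RV P >-> X}.
Hypothesis na : non_atomic mu.
Hypothesis indep : mutually_independent xi.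
Hypothesis law : forall (j : 'I_n) (A : set X), measurable A ->
  distribution P (xi j) A = mu A.

Let b : R := Num.sqrt n%:R.
Let c : R := k%:R / b.

Let coloring_avg (y : 'I_n -> X) (f : k.-tuple X -> R) : R :=
  avg (fun pi : {ffun 'I_n -> 'I_k} => multi (centered mu pi b c finset.set0 y) f).

Lemma random_integral_coloring (y : 'I_n -> X) (f : k.-tuple X -> R) :
  injective y -> bmf f -> random_integral mu y f = (k`!)%:R^-1 * coloring_avg y f.
Proof.
move=> yi bf; rewrite /random_integral.
have -> : off_diagonal f = avoiding [::] f.
  apply/funext => v; rewrite /off_diagonal /avoiding.
  by rewrite (_ : all _ _) ?andbT//; apply/allP.
rewrite (iterated_integral_coloring (non_atomic_point na) k0 yi _ (leqnn k) bf).
have b0 : 0 < b by rewrite sqrtr_gt0 ltr0n.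
have -> : n%:R `^ (k%:R / 2) = b ^+ k :> R.
  by rewrite mulrC powRrM powR12_sqrt// powR_mulrn// sqrtr_ge0.
rewrite mulrAC -avgZl mulrC; congr (_ * _); apply: eq_avg => pi.
rewrite (_ : finset.finset _ = finset.set0); last first.
  by apply/setP => j; rewrite !inE.
rewrite -multi_centered_scale// mulr1; congr (multi (centered _ _ _ _ _ _) f).
rewrite /c (_ : n%:R = b ^+ 2); last by rewrite sqr_sqrtr.
by field; rewrite gt_eqF.
Qed.

Let Xi (w : Omega) : n.-tuple X := [tuple xi j w | j < n].

Let measurable_Xi : measurable_fun setT Xi.
Proof.
apply/measurable_fun_tnthP => j.
rewrite (_ : _ \o _ = xi j); first exact: measurable_funPT.
by apply/funext => w; rewrite /= tnth_mktuple.
Qed.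

Let Xi_law A : (forall i, measurable (A i)) ->
  P (Xi @^-1` rect A) = (\prod_(i < n) mu (A i))%E.
Proof.
move=> mA; have := indep finset.setT mA.
rewrite (_ : \bigcap_(j in _) _ = Xi @^-1` rect A).
  move=> ->; rewrite (eq_bigl xpredT) => [|j]; last by rewrite finset.in_setT.
  by apply: eq_bigr => j _; exact: law.
apply/seteqP; split => w /= h j.
  by rewrite tnth_mktuple; apply: h => /=; rewrite inE.
by move=> _; have := h j; rewrite tnth_mktuple.
Qed.

Lemma collision_negligible : P.-negligible [set w | ~ injective (fun j => xi j w)].
Proof.
pose F (l : nat) : set Omega := match unpickle l with
  | Some (i, j) => if (i : 'I_n) != j then [set w | xi i w = xi j w] else set0
  | None => set0 end.
apply: (@negligibleS _ _ _ _ (\bigcup_l F l)).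
  move=> w /= /existsNP[i /existsNP[j /not_implyP[e ij]]].
  exists (pickle (i, j)) => //; rewrite /F pickleK.
  by case: eqP.
apply: negligible_bigcup => l; rewrite /F.
case: unpickle => [[i j]|]; last exact: negligible_set0.
case: ifPn => ij; last exact: negligible_set0.
apply: (non_atomic_diagonal na); [exact: measurable_funPT|exact: measurable_funPT|].
move=> A B mA mB; pose AB (l : 'I_n) := if l == i then A else B.
have mAB l' : measurable (AB l') by rewrite /AB; case: ifP.
have := indep (i |: [set j])%SET mAB.
rewrite finset.big_setU1 ?finset.in_set1//= finset.big_set1 /AB eqxx eq_sym (negbTE ij).
rewrite (_ : \bigcap_(_ in _) _ = xi i @^-1` A `&` xi j @^-1` B).
  by move=> ->; congr (_ * _)%E; exact: law.
apply/seteqP; split => w /=.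
  move=> h; split; first by have := h i; rewrite /= eqxx; apply; rewrite !inE eqxx.
  have := h j; rewrite /= eq_sym (negbTE ij); apply; rewrite !inE eqxx orbT//.
move=> [hi hj] l'; rewrite /= !inE => /orP[/eqP->|/eqP->]; first by rewrite eqxx.
by rewrite eq_sym (negbTE ij).
Qed.

(** Markov's inequality for the maxima over the first functions of an enumeration
    of [F'], whose events increase.  A supremum of at least [x] need not be
    attained, but the value [x / 2] is exceeded by a member. *)
Lemma tail_moment (D L : R) (F F' : set (k.-tuple X -> R)) (x : R) (q : nat) :
  L2_dense D L F -> (forall f, F f -> forall u, `|f u| <= 1) ->
  F' `<=` F -> countable F' -> 0 < x -> (0 < q)%N -> 2 * L <= q%:R ->
  exists U : set Omega, [/\ measurable U,
    sup_event mu xi F' x `<=` U `|` [set w | ~ injective (fun j => xi j w)] &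
    (P U <= (((x / 2) ^+ 2) ^- q * ((`|D| + D ^+ 2 * 8 `^ L + 1) *
      (k%:R * (moment_constant R k * q%:R) ^+ (k * q))))%:E)%E].
Proof.
move=> dF F1 F'F cF' x0 q0 qL; set Bd := (_ + _ + 1) * _.
have Bd0 : 0 <= Bd.
  rewrite mulr_ge0//; first by rewrite addr_ge0// addr_ge0// mulr_ge0 ?sqr_ge0 ?powR_ge0.
  by rewrite mulr_ge0// exprn_ge0// mulr_ge0// ltW// moment_constant_gt0.
set a := ((x / 2) ^+ 2) ^+ q.
have a0 : 0 < a by rewrite exprn_gt0// exprn_gt0// divr_gt0.
have [F'0|/set0P[f0 F'f0]] := eqVneq F' set0.
  exists set0; split => //; last by rewrite measure0 lee_fin mulr_ge0// invr_ge0 ltW.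
  by move=> w; rewrite /sup_event/= F'0 image_set0 ereal_sup0.
have /countable_injP[g gi] := cF'.
have /choice[e he] : forall i : nat, exists f, F' f /\
    (forall f', F' f' -> g f' = i -> f' = f).
  move=> i; have [[f [F'f fi]]|h] := pselect (exists f, F' f /\ g f = i).
    by exists f; split => // f' F'f' f'i; apply: gi; rewrite ?inE// fi.
  by exists f0; split => // f' F'f' f'i; exfalso; apply: h; exists f'.
have Fe i : F (e i) by apply: F'F; case: (he i).
have be i : bmf (e i).
  by split; [exact: dF.1|exists 1 => v; exact: F1].
pose M N (y : n.-tuple X) := \big[Num.max/0]_(l < N)
  ((coloring_avg (tnth y) (e l) ^+ 2) ^+ q).
have bM N : bmf (M N).
  apply: bmf_bigmax => l; do 2 apply: bmfX; apply: bmfZ; apply: bmf_sum => pi.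
  apply: (multi_bmf (phi := idfun) (nu := fun y : n.-tuple X =>
    centered mu pi b c finset.set0 (tnth y))
    (G := fun q : n.-tuple X * k.-tuple X => e l q.2)).
  + by move=> i; apply: bkernel_centered => j; exact: measurable_tnth.
  + exact: measurable_id.
  + exact: (bmf_comp measurable_snd (be l)).
have bMX N : bmf (fun w => M N (Xi w)) by exact: (bmf_comp measurable_Xi (bM N)).
pose E N : set Omega := [set w | a <= M N (Xi w)].
have mE N : measurable (E N).
  rewrite (_ : E N = setT `&` (fun w => M N (Xi w)) @^-1` `[a, +oo[%classic).
    by apply: (bMX N).1 => //; exact: measurable_itv.
  by apply/seteqP; split => w /=; rewrite in_itv/= andbT// => -[].
have mUE : measurable (\bigcup_N E N) by exact: bigcup_measurable.
have PE N : (P (E N) <= (a^-1 * Bd)%:E)%E.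
  have bI : bmf (\1_(E N) : Omega -> R).
    split; first exact: measurable_indic.
    by exists 1 => w; rewrite indicE; case: (_ \in _); rewrite ?normr1 ?normr0.
  have : \int[P]_w (a * \1_(E N) w) <= Bd.
    apply: (@le_trans _ _ (\int[P]_w M N (Xi w))).
      apply: le_Eint => //; first exact: bmfZ.
      move=> w; rewrite indicE; have [wE|_] := boolP (w \in E N).
        by rewrite mulr1; move: wE; rewrite inE.
      rewrite mulr0 /M; elim/big_ind: _ => // [u v u0 _|l _].
        by rewrite le_max u0.
      by rewrite exprn_ge0// sqr_ge0.
    rewrite (Eint_tuple_law measurable_Xi Xi_law (bM N)).
    exact: (sup_moment mu n0 k0 dF F1 q0 qL).
  rewrite EintZ// -ler_pdivlMl// /Rintegral integral_indic// setIT => h.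
  by rewrite -[leLHS]fineK ?fin_num_measure// lee_fin.
exists (\bigcup_N E N); split => //.
- move=> w xw; have [yi|] := pselect (injective (fun j => xi j w)); last by right.
  left; have : ((x / 2)%:E < ereal_sup [set `|random_integral mu (fun j => xi j w) f|%:E
      | f in F'])%E.
    by apply: lt_le_trans xw; rewrite lte_fin ltr_pdivrMr// ltr_pMr// ltr1n.
  move=> /ereal_sup_gt[_ [f F'f <-]]; rewrite lte_fin => hf.
  have fe : f = e (g f) by case: (he (g f)) => _; exact.
  exists (g f).+1 => //; rewrite /E /M/=.
  apply: le_trans (le_bigmax _ (fun l : 'I_(g f).+1 =>
    ((coloring_avg (tnth (Xi w)) (e l) ^+ 2) ^+ q)) ord_max).
  rewrite /= -fe; apply: ler_exprn; first exact: sqr_ge0.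
  rewrite -[leRHS]real_normK ?num_real//; apply: ler_exprn.
    by rewrite ltW// divr_gt0.
  apply: ltW; apply: lt_le_trans hf _; rewrite random_integral_coloring//; last first.
    by rewrite fe.
  rewrite normrM ger0_norm ?invr_ge0//.
  have -> : tnth (Xi w) = fun j => xi j w.
    by apply/funext => j; rewrite tnth_mktuple.
  by rewrite ler_piMl// invf_le1 ?ler1n ?ltr0n fact_gt0.
- have EN : {homo E : i j / (i <= j)%N >-> (i <= j)%O}.
    apply/nondecreasing_seqP => N; apply/subsetPset => w /= h.
    apply: le_trans h _; pose V (l : nat) := (coloring_avg (tnth (Xi w)) (e l) ^+ 2) ^+ q.
    have V_le l : (l < N.+1)%N -> V l <= M N.+1 (Xi w).
      by move=> lN; exact: (le_bigmax _ (fun l : 'I_N.+1 => V l) (Ordinal lN)).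
    apply/bigmax_leP; split => [|l _]; last by apply: V_le; rewrite ltnS ltnW.
    by apply: le_trans (V_le 0%N isT); rewrite exprn_ge0// sqr_ge0.
  have cE := @nondecreasing_cvg_mu _ _ _ P E mE mUE EN.
  rewrite -(cvg_lim (@ereal_hausdorff R) cE); apply: lime_le.
    by apply/cvg_ex; exists (P (\bigcup_N E N)).
  by apply: nearW => N; exact: PE.
Qed.

End TailBound.

Lemma completion_le (R : realType) d (T : measurableType d) (P : probability T R)
    (A U N : set T) :
  measurable U -> P.-negligible N -> A `<=` U `|` N ->
  (@completed_measure_extension _ _ _ P A <= P U)%E.
Proof.
move=> mU [N' [mN' N'0 NN']] AUN; rewrite /completed_measure_extension.
apply: (@le_trans _ _ ((P^*)%mu (U `|` N'))).
  apply: le_mu_ext; apply: subset_trans AUN _; exact: setUS.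
have mUN : measurable (U `|` N') by exact: measurableU.
rewrite measurable_mu_extE//.
by apply: le_trans (measureU2 _ mU mN') _; rewrite [X in (_ + X)%E]N'0 adde0.
Qed.

(** The exponent [q] is chosen of order [x `^ (2 / k)], which turns the moment
    bound into an exponential one; small [x] are absorbed by the constant. *)
Lemma optimize_exponent (R : realType) (k : nat) (A C L x p : R) :
  (0 < k)%N -> 0 < A -> 0 <= C -> 0 < x -> p <= 1 ->
  (forall q, (0 < q)%N -> 2 * L <= q%:R ->
     p <= ((x / 2) ^+ 2) ^- q * (C * (k%:R * (A * q%:R) ^+ (k * q)))) ->
  p <= (C * k%:R * expR k%:R + expR (Num.truncn `|2 * L|).+1%:R) *
       expR (- (4 * A * expR 1)^-1 * x `^ (2 / k%:R)).
Proof.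
move=> k0 A0 C0 x0 p1 hq; have e0 : 0 < expR 1 :> R by exact: expR_gt0.
have k1 : 1 <= k%:R :> R by rewrite ler1n.
have kn0 : k%:R != 0 :> R by rewrite pnatr_eq0 -lt0n.
have x20 : 0 < x / 2 by rewrite divr_gt0.
pose t := (x / 2) `^ (2 / k%:R).
have t0 : 0 < t by exact: powR_gt0.
have tk : t ^+ k = (x / 2) ^+ 2.
  by rewrite -!powR_mulrn ?powR_ge0 ?ltW// -powRrM divfK.
have xt : x `^ (2 / k%:R) <= 4 * t.
  have -> : x `^ (2 / k%:R) = 2 `^ (2 / k%:R) * t.
    by rewrite /t -powRM ?(ltW x20)//; congr (_ `^ _); field.
  rewrite ler_wpM2r ?(ltW t0)//.
  apply: (@le_trans _ _ (2 `^ 2%:R)); last by rewrite powR_mulrn//; lra.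
  by rewrite ler_powR ?ler1n// ler_pdivrMr ?ltr0n// ler_peMr.
set r := t / (A * expR 1).
have Ae0 : 0 < A * expR 1 by exact: mulr_gt0.
have r0 : 0 < r by exact: divr_gt0.
set s := (4 * A * expR 1)^-1 * x `^ (2 / k%:R).
have sr : s <= r.
  rewrite /s /r mulrC ler_pdivrMr; last by rewrite mulr_gt0// mulr_gt0.
  by rewrite -[4 * A * _]mulrA mulrCA divfK ?gt_eqF.
rewrite mulNr -/s; pose q := Num.truncn r; pose q0 := (Num.truncn `|2 * L|).+1.
have /andP[qr rq] := truncn_itv (ltW r0).
have Ck0 : 0 <= C * k%:R by rewrite mulr_ge0.
rewrite -/q0 mulrDl; have [qq0|q0q] := ltnP q q0.
  apply: (le_trans p1); rewrite ler_wpDl ?mulr_ge0 ?expR_ge0// -expRD.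
  rewrite -[leLHS]expR0 ler_expR subr_ge0 (le_trans sr)//.
  by apply: le_trans (ltW rq) _; rewrite ler_nat.
apply: (@le_trans _ _ (C * k%:R * expR k%:R * expR (- s))); last first.
  by rewrite lerDl mulr_ge0// expR_ge0.
have q_gt0 : (0 < q)%N by exact: leq_trans q0q.
apply: le_trans (hq q q_gt0 _) _.
  apply: (le_trans (ler_norm _)); apply: ltW.
  by apply: lt_le_trans (truncnS_gt _) _; rewrite ler_nat.
rewrite -tk -exprM [leLHS](_ : _ = C * k%:R * (A * q%:R / t) ^+ (k * q)); last first.
  by rewrite expr_div_n mulrC !mulrA.
rewrite -[leRHS]mulrA; apply: ler_wpM2l => //.
apply: (@le_trans _ _ ((expR 1)^-1 ^+ (k * q))).
  apply: ler_exprn; first by rewrite divr_ge0 ?(ltW t0)// mulr_ge0// ltW.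
  have qt : q%:R * (A * expR 1) <= t by rewrite -ler_pdivlMr.
  rewrite ler_pdivrMr// ler_pdivlMl//; apply: le_trans qt.
  by rewrite [leLHS]mulrC [A * q%:R]mulrC -mulrA.
rewrite -expRN -expRM_natl -expRD ler_expR mulrN mulr1 natrM.
have kq : k%:R * (r - 1) <= k%:R * q%:R :> R.
  by rewrite ler_wpM2l//; move: rq; rewrite -/q -natr1; lra.
have kr : r <= k%:R * r by rewrite ler_peMl// ltW.
by move: kq; rewrite mulrBr mulr1; lra.
Qed.

Theorem corollary2 (R : realType) (k : nat) (hk : (0 < k)%N) :
  exists2 alpha : R, 0 < alpha &
  forall D L : R, exists2 C : R, 0 < C &
  forall (d : measure_display) (X : measurableType d) (mu : probability X R)
    (n : nat) (dO : measure_display) (Omega : measurableType dO)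
    (P : probability Omega R) (xi : 'I_n -> {RV P >-> X})
    (F : set (k.-tuple X -> R)),
  non_atomic mu ->
  (0 < n)%N ->
  mutually_independent xi ->
  (forall (j : 'I_n) (A : set X), measurable A ->
    distribution P (xi j) A = mu A) ->
  L2_dense D L F ->
  countable F \/ countably_majorizable mu xi F ->
  (forall f, F f -> forall u, `|f u| <= 1) ->
  forall x : R, 0 < x ->
    (@completed_measure_extension _ _ _ P (sup_event mu xi F x) <=
     (C * expR (- alpha * x `^ (2 / k%:R)))%:E)%E.
Proof.
pose A := moment_constant R k; have A0 : 0 < A by exact: moment_constant_gt0.
have e0 : 0 < expR 1 :> R by exact: expR_gt0.
exists (4 * A * expR 1)^-1 => [|D L].
  by rewrite invr_gt0 mulr_gt0// mulr_gt0.
pose C := `|D| + D ^+ 2 * 8 `^ L + 1.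
have C0 : 0 <= C by rewrite addr_ge0// addr_ge0// mulr_ge0 ?sqr_ge0 ?powR_ge0.
exists (C * k%:R * expR k%:R + expR (Num.truncn `|2 * L|).+1%:R).
  by rewrite ltr_wpDl ?expR_gt0// mulr_ge0 ?expR_ge0// mulr_ge0.
move=> d X mu n dO Omega P xi F na n0 indep law dF cF F1 x x0.
have [F' [cF' F'F neg]] : exists F' : set (k.-tuple X -> R), [/\ countable F',
    F' `<=` F & P.-negligible (sup_event mu xi F x `\` sup_event mu xi F' x)].
  case: cF => [cF|[F' [cF' F'F neg]]]; last by exists F'; split => //; exact: neg.
  by exists F; split => //; rewrite setDv; exact: negligible_set0.
set S := sup_event mu xi F x.
have S_le U : measurable U ->
    sup_event mu xi F' x `<=` U `|` [set w | ~ injective (fun j => xi j w)] ->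
    (@completed_measure_extension _ _ _ P S <= P U)%E.
  move=> mU hU; have bad := collision_negligible na indep law.
  apply: (completion_le mU (negligibleU bad neg)) => w Sw.
  have [F'w|F'w] := pselect (sup_event mu xi F' x w); last by right; right.
  by case: (hU w F'w) => [|]; [left|right; left].
have S1 : (@completed_measure_extension _ _ _ P S <= 1)%E.
  apply: le_trans (S_le setT measurableT _) _; first by move=> w _; left.
  by rewrite -[leRHS](probability_setT P).
have S0 : (0 <= @completed_measure_extension _ _ _ P S)%E by exact: mu_ext_ge0.
have Sfin : @completed_measure_extension _ _ _ P S \is a fin_num.
  by rewrite ge0_fin_numE// (le_lt_trans S1)// ltry.
rewrite -[leLHS]fineK// lee_fin; apply: optimize_exponent => //.
  by rewrite -lee_fin fineK.
move=> q q0 qL.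
have [U [mU hU PU]] := tail_moment n0 hk na indep law dF F1 F'F cF' x0 q0 qL.
by rewrite -lee_fin fineK//; exact: le_trans (S_le U mU hU) PU.
Qed.
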